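(* For $n\geq1$ put $$D_n:=\sup\bigl\{d_{\mathrm{BM}}(Z,B_2^n): Z\subset\mathbb{R}^n,\ Z\text{ and }Z^\circ\text{ are zonoids}\bigr\}.$$ Then $D_n$ is bounded away from $1$ uniformly in $n\geq2$, i.e. there is $\delta>0$ such that $D_n\geq1+\delta$ for all $n\geq2$. Consequently $D_n$ does not converge to $1$ as $n\to\infty$.
   Context: Convex bodies in $\mathbb{R}^n$ are compact, convex, origin-symmetric sets with nonempty interior. The support function of $K$ is $h_K(u)=\max_{y\in K}\langle u,y\rangle$, and the polar body is $K^\circ=\{u\in\mathbb{R}^n: h_K(u)\leq 1\}$. A (centrally symmetric) zonotope is a set $\sum_{j=1}^N[-v_j,v_j]$ (Minkowski sum of segments, $v_j\in\mathbb{R}^n$). A zonoid is an origin-symmetric convex body that is a limit of zonotopes in the Hausdorff metric; equivalently, there is a finite even positive Borel measure $\mu$ on the unit sphere $\mathbb{S}^{n-1}$ with $h_Z(u)=\int_{\mathbb{S}^{n-1}}|\langle u,v\rangle|\,d\mu(v)$. $B_2^n$ is the closed Euclidean unit ball of $\mathbb{R}^n$. The Banach--Mazur distance between origin-symmetric convex bodies $K,L\subset\mathbb{R}^n$ is $d_{\mathrm{BM}}(K,L)=\inf\{a\geq1: L\subset TK\subset aL\text{ for some }T\in GL(n,\mathbb{R})\}$. *)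

(* Defs.v *)
(* R^n is the space 'rV[R]_n of row vectors, with its canonical topology. *)
From HB Require Import structures.
From mathcomp Require Import all_boot all_order all_algebra.
From mathcomp Require Import all_classical all_reals all_analysis.

Set Implicit Arguments.
Unset Strict Implicit.
Unset Printing Implicit Defensive.

Import Order.TTheory GRing.Theory Num.Theory.
Import numFieldNormedType.Exports.

Local Open Scope classical_set_scope.
Local Open Scope ring_scope.

Section ConvexBodies.
Variables (R : realType) (n : nat).
Implicit Types (u v x : 'rV[R]_n) (K L Z : set 'rV[R]_n).

(* The library norm on 'rV[R]_n is the sup norm, so the Euclidean structure is
   introduced here; both norms induce the same (product) topology. *)
Definition dotv u v : R := \sum_(i < n) u 0 i * v 0 i.

Definition euclidean_norm x : R := Num.sqrt (dotv x x).

Definition euclidean_ball : set 'rV[R]_n := [set x | euclidean_norm x <= 1].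

Definition convex_body K : Prop :=
  [/\ compact K, convex_set K, (forall x, K x -> K (- x)) & interior K !=set0].

(* For a nonempty compact K the supremum is attained. *)
Definition support_function K u : R := sup [set dotv u y | y in K].

Definition polar K : set 'rV[R]_n := [set u | support_function K u <= 1].

Definition minkowski_sum K L : set 'rV[R]_n := [set x + y | x in K & y in L].

Definition dilate (a : R) K : set 'rV[R]_n := [set a *: x | x in K].

Definition segment v : set 'rV[R]_n := [set t *: v | t in `[(-1 : R), 1]].

Definition zonotope K : Prop :=
  exists (N : nat) (v : 'I_N -> 'rV[R]_n),
    K = \big[minkowski_sum/[set 0]]_(j < N) segment (v j).

Definition hausdorff_dist K L : R :=
  inf [set e | [/\ 0 <= e,
                   K `<=` minkowski_sum L (dilate e euclidean_ball) &
                   L `<=` minkowski_sum K (dilate e euclidean_ball)]].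

(* The approximating zonotopes may have empty interior. *)
Definition zonoid Z : Prop :=
  convex_body Z /\
  exists P : nat -> set 'rV[R]_n,
    (forall k, zonotope (P k)) /\
    (fun k => hausdorff_dist (P k) Z) @ \oo --> (0 : R).

(* GL(n, R) is given by the invertible matrices, acting on row vectors on the
   right. *)
Definition banach_mazur K L : R :=
  inf [set a | 1 <= a /\
               exists T : 'M[R]_n,
                 [/\ T \in unitmx, L `<=` [set x *m T | x in K] &
                     [set x *m T | x in K] `<=` dilate a L]].

End ConvexBodies.

(* The supremum is taken in the extended reals, so that its meaning does not
   depend on a proof that the set is bounded. *)
Definition max_bm_dist (R : realType) (n : nat) : \bar R :=
  ereal_sup [set (banach_mazur Z (@euclidean_ball R n))%:E |
              Z in [set Z : set 'rV[R]_n | zonoid Z /\ zonoid (polar Z)]].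

(* Main.v *)
Require Import Defs.
From mathcomp Require Import all_boot all_order all_algebra.
From mathcomp Require Import all_classical all_reals all_analysis.
From mathcomp Require Import measurable_realfun.
From mathcomp Require Import ring lra.

Import Order.TTheory GRing.Theory Num.Theory.
Import numFieldNormedType.Exports.

Local Open Scope classical_set_scope.
Local Open Scope ring_scope.

(* The extremal body is a body of revolution. Write R^n = R^(n-1) + R axis, let q
   be the Euclidean norm of the first component and t the last coordinate. If g is
   completely monotone, the integral of max (|t|, q v) g(v^2) over v >= 0 is the
   support function of a zonoid: g is a mixture of Gaussians exp (- b v^2), and for
   one of these the integral is, up to a factor, the mean of |t + <u, X>| for a
   Gaussian vector X. The planar norm (r^2 + s^2) / sqrt (2 r^2 + s^2) has this form
   with density 6 (2 + v^2)^(-5/2), and so has its dual norm, whose density is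
   (4/3) w^(-1/2) (w - 1)^(-3) with w^3 - 3 w = 4 v^2 + 2. This last density is
   completely monotone in v^2 because w is a Bernstein function: it is the limit of
   the contraction w |-> (4 v^2 + 2 + 3 w)^(1/3), and pth roots of Bernstein
   functions are limits of log-periodic series of functions 1 - exp (- c psi).
   The revolved norms are thus dual to each other and both are support functions of
   zonoids, and they violate the parallelogram law in a plane through the axis by an
   amount independent of n. *)

(** * Duality and the zonoid criterion *)

(** In the plane every norm is the support function of a zonoid; the difficulty is that the revolved
    body and its polar must be zonoids in every dimension. Complete monotonicity in v^2 settles this
    for all n at once: a linear functional of a Gaussian vector of R^(n-1) is a one-dimensional
    Gaussian, whatever n is, so one planar pair of norms serves every n. Since zonoids are defined
    as Hausdorff limits of zonotopes, the integrals have to be turned into uniform limits of finite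
    sums of |<u, v>|. Likewise, complete monotonicity is never tested by signs of derivatives: the
    class is generated by exponentials, sums and limits, and membership must be built up. Hence the
    treatment of roots: the integral of (1 - exp (- t psi)) t^(-1-1/p), which represents psi^(1/p)
    up to a factor, is replaced by its Riemann sums over the geometric grid t = rho^(p i); these
    scale exactly, and monotonicity alone controls their error. For this planar norm the duality is
    explicit: tangents are parametrised by a real x through a cubic that Cardano's formula
    inverts. *)

Lemma continuous_sum {R : realType} {T : topologicalType} (N : nat)
    (f : 'I_N -> T -> R) :
  (forall i, continuous (f i)) -> continuous (fun x => \sum_(i < N) f i x).
Proof.
by move=> cf; apply: (continuous_big (@add_continuous _)) => i _; exact: cf.
Qed.

Lemma convex_setP {R : realType} {M : lmodType R} (A : set M) :
  convex_set A <->
  (forall x y t, 0 <= t <= 1 -> A x -> A y -> A (t *: x + (1 - t) *: y)).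
Proof.
split=> [cA x y t t01 Ax Ay|cA x y t /set_mem Ax /set_mem Ay]; last first.
  by apply: mem_set; apply: cA => //; rewrite ge0 le1.
have tI : Itv.spec (@Itv.num_sem R) (Itv.Real `[0%Z, 1%Z]) t.
  by rewrite /= /Itv.num_sem/= num_real in_itv.
exact: (set_mem (cA x y (Itv.mk tI) (mem_set Ax) (mem_set Ay))).
Qed.

Section Euclidean.
Context {R : realType} {n : nat}.
Implicit Types (u v x y : 'rV[R]_n) (K L : set 'rV[R]_n).

Local Notation enorm := (@euclidean_norm R n).

Lemma dotvC u v : dotv u v = dotv v u.
Proof. by apply: eq_bigr => i _; rewrite mulrC. Qed.

Lemma dotvDl u v x : dotv (u + v) x = dotv u x + dotv v x.
Proof. by rewrite -big_split; apply: eq_bigr => i _; rewrite mxE mulrDl. Qed.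

Lemma dotvZl a u x : dotv (a *: u) x = a * dotv u x.
Proof. by rewrite mulr_sumr; apply: eq_bigr => i _; rewrite mxE mulrA. Qed.

Lemma dotvNl u x : dotv (- u) x = - dotv u x.
Proof. by rewrite -scaleN1r dotvZl mulN1r. Qed.

Lemma dotvDr u v x : dotv x (u + v) = dotv x u + dotv x v.
Proof. by rewrite dotvC dotvDl !(dotvC x). Qed.

Lemma dotvZr a u x : dotv x (a *: u) = a * dotv x u.
Proof. by rewrite dotvC dotvZl (dotvC x). Qed.

Lemma dotvNr u x : dotv x (- u) = - dotv x u.
Proof. by rewrite dotvC dotvNl (dotvC x). Qed.

Lemma dotv0l x : dotv 0 x = 0.
Proof. by rewrite -(scale0r 0) dotvZl mul0r. Qed.

Lemma dotv_ge0 u : 0 <= dotv u u.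
Proof. by apply: sumr_ge0 => i _; rewrite -expr2 sqr_ge0. Qed.

Lemma dotv_eq0 u : dotv u u = 0 -> u = 0.
Proof.
move=> u0; apply/rowP => i; rewrite mxE.
have /psumr_eq0P : forall i, true -> 0 <= u 0 i * u 0 i.
  by move=> j _; rewrite -expr2 sqr_ge0.
by move/(_ u0 i erefl)/eqP; rewrite mulf_eq0 orbb => /eqP.
Qed.

Lemma enorm_ge0 u : 0 <= enorm u.
Proof. exact: sqrtr_ge0. Qed.

Lemma sqr_enorm u : enorm u ^+ 2 = dotv u u.
Proof. by rewrite sqr_sqrtr// dotv_ge0. Qed.

Lemma enorm0 : enorm 0 = 0.
Proof. by rewrite /euclidean_norm dotv0l sqrtr0. Qed.

Lemma enormZ a u : enorm (a *: u) = `|a| * enorm u.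
Proof.
by rewrite /euclidean_norm dotvZl dotvZr mulrA -expr2 sqrtrM ?sqr_ge0// sqrtr_sqr.
Qed.

Lemma cauchy_schwarz u v : `|dotv u v| <= enorm u * enorm v.
Proof.
rewrite -(ler_pXn2r (n := 2)) ?nnegrE ?mulr_ge0 ?enorm_ge0//.
rewrite exprMn !sqr_enorm real_normK ?num_real//.
have [u0|u0] := eqVneq (dotv u u) 0.
  by rewrite (dotv_eq0 _ u0) !dotv0l expr0n mul0r.
have upos : 0 < dotv u u by rewrite lt_def u0 dotv_ge0.
have := dotv_ge0 (dotv u u *: v - dotv u v *: u).
rewrite !(dotvDl, dotvDr, dotvZl, dotvZr, dotvNl, dotvNr) (dotvC v u).
set a := dotv u u in upos *; set b := dotv u v; set c := dotv v v => H.
rewrite -subr_ge0 -(pmulr_rge0 _ upos).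
by apply: le_trans H _; rewrite le_eqVlt; apply/orP; left; apply/eqP; ring.
Qed.

Lemma dotvBZ u v (t : R) : dotv (u - t *: v) (u - t *: v) =
  dotv u u - t * dotv u v *+ 2 + t * (t * dotv v v).
Proof.
rewrite !(dotvDl, dotvDr, dotvZl, dotvZr, dotvNl, dotvNr) (dotvC v u).
by rewrite mulr2n; ring.
Qed.

Lemma enorm_coord u i : `|u 0 i| <= enorm u.
Proof.
rewrite -sqrtr_sqr ler_wsqrtr// /dotv (bigD1 i)//= -expr2 lerDl.
by apply: sumr_ge0 => j _; rewrite -expr2 sqr_ge0.
Qed.

Lemma continuous_dotv u : continuous (fun v => dotv u v).
Proof.
apply: continuous_sum => i v.
by apply: continuousM; [exact: cst_continuous|exact: coord_continuous].
Qed.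

(* The optimality condition at the point of [K] nearest to [y] is that the
   residual [y - k0] is an outer normal of [K] at [k0]. *)
Lemma mem_minkowski_sum_ball K y (e : R) : compact K -> convex_set K -> K !=set0 ->
  0 <= e ->
  (forall u, exists2 k, K k & dotv u y <= dotv u k + e * enorm u) ->
  minkowski_sum K (dilate e (@euclidean_ball R n)) y.
Proof.
move=> cK vK K0 e0 H.
have cf : continuous (fun k : 'rV[R]_n => dotv (y - k) (y - k)).
  have c1 i : continuous (fun x : 'rV[R]_n => (y - x) 0 i).
    under eq_fun do rewrite !mxE.
    move=> x; apply: continuousB; first exact: cst_continuous.
    exact: coord_continuous.
  by apply: continuous_sum => i k; apply: continuousM; exact: c1.
have [k0 /set_mem Kk0 min] := compact_EVT_min K0 cK (continuous_subspaceT cf).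
pose r := y - k0.
have normal k : K k -> dotv r (k - k0) <= 0.
  move=> Kk; rewrite leNgt; apply/negP => rk.
  set c := dotv r (k - k0) in rk; set d := dotv (k - k0) (k - k0).
  have d0 : 0 <= d := dotv_ge0 _.
  (* Moving from [k0] towards [k] by [t] changes the squared distance to [y] by t (t d - 2 c). This
     choice makes it negative, is at most 1, and makes sense also for d = 0. *)
  pose t := c / (c + d).
  have cd : 0 < c + d by lra.
  have t0 : 0 < t by exact: divr_gt0.
  have t1 : t <= 1 by rewrite ler_pdivrMr// mul1r; lra.
  have Kt : K (k0 + t *: (k - k0)).
    have t01 : 0 <= t <= 1 by rewrite (ltW t0).
    have := (convex_setP K).1 vK k k0 t t01 Kk Kk0; congr (K _).
    by rewrite scalerBr scalerBl scale1r addrCA.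
  have := min _ (mem_set Kt).
  have -> : y - (k0 + t *: (k - k0)) = r - t *: (k - k0).
    by rewrite opprD addrA.
  rewrite -/r dotvBZ -/c -/d.
  have tcd : t * (c + d) = c by rewrite /t divfK// gt_eqF.
  have td : t * d < c *+ 2 by rewrite mulr2n; nra.
  nra.
(* The hypothesis is tested in the direction of the residual itself; [normal] then leaves |r|^2 <= e
   |r|. *)
have [k Kk Hk] := H r.
have := normal _ Kk.
rewrite !(dotvDr, dotvNr) => nk.
have rr : dotv r r <= e * enorm r.
  have -> : dotv r r = dotv r y - dotv r k0 by rewrite -dotvNr -dotvDr.
  lra.
rewrite -sqr_enorm in rr.
have re : enorm r <= e.
  have := enorm_ge0 r; rewrite le_eqVlt => /orP[/eqP<-//|r0].
  by rewrite -(ler_pM2r r0) -expr2.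
exists k0 => //; exists r; last by rewrite /r addrC subrK.
have [e00|e00] := eqVneq e 0.
  exists 0; first by rewrite /euclidean_ball/= enorm0.
  have r00 : enorm r = 0 by apply/eqP; rewrite eq_le enorm_ge0 andbT -e00.
  have /dotv_eq0 -> : dotv r r = 0 by rewrite -sqr_enorm r00 expr0n.
  by rewrite scaler0.
exists (e^-1 *: r); last by rewrite scalerA divff// scale1r.
rewrite /euclidean_ball/= enormZ ger0_norm ?invr_ge0//.
by rewrite mulrC ler_pdivrMr ?mul1r// lt_def e00.
Qed.

Lemma minkowski_sumE K L x :
  minkowski_sum K L x = exists y z, [/\ K y, L z & x = y + z].
Proof.
apply/propext; split=> [[y Ky [z Lz <-]]|[y [z [Ky Lz ->]]]].
  by exists y, z.
by exists y => //; exists z.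
Qed.

Lemma compact_minkowski_sum K L :
  compact K -> compact L -> compact (minkowski_sum K L).
Proof.
move=> cK cL.
have -> : minkowski_sum K L = [set p.1 + p.2 | p in K `*` L].
  apply/seteqP; split=> x.
    by move=> [y Ky [z Lz <-]]; exists (y, z).
  by move=> [[y z] [/= Ky Lz] <-]; exists y => //; exists z.
apply: continuous_compact; last exact: compact_setX.
by apply: continuous_subspaceT; exact: add_continuous.
Qed.

Lemma convex_minkowski_sum K L :
  convex_set K -> convex_set L -> convex_set (minkowski_sum K L).
Proof.
move=> /convex_setP cK /convex_setP cL; apply/convex_setP.
move=> _ _ t t01 [y Ky [z Lz <-]] [y' Ky' [z' Lz' <-]].
rewrite minkowski_sumE; exists (t *: y + (1 - t) *: y').
exists (t *: z + (1 - t) *: z'); split; [exact: cK|exact: cL|].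
by rewrite !scalerDr addrACA.
Qed.

Lemma compact_segment v : compact (segment v).
Proof.
apply: continuous_compact; last exact: segment_compact.
apply: continuous_subspaceT => t.
exact: scalel_continuous.
Qed.

Lemma convex_segment v : convex_set (segment v).
Proof.
apply/convex_setP => _ _ t /andP[t0 t1] [a + <-] [b + <-].
rewrite /= !in_itv/= => /andP[a1 a2] /andP[b1 b2].
exists (t * a + (1 - t) * b); last by rewrite !scalerA -scalerDl.
by rewrite /= in_itv/=; apply/andP; split; nra.
Qed.

(** Support functions add up under Minkowski sums, and that of [-v, v] is |<u, v>|, attained at the
    multiple of v by the sign of <u, v>. Compactness and convexity are recorded for the
    nearest-point argument. *)
Lemma zonotopeP (N : nat) (v : 'I_N -> 'rV[R]_n) :
  let P := \big[@minkowski_sum R n/[set 0]]_(j < N) segment (v j) in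
  [/\ compact P, convex_set P,
    (forall u p, P p -> dotv u p <= \sum_(j < N) `|dotv u (v j)|) &
    (forall u, exists2 p, P p & dotv u p = \sum_(j < N) `|dotv u (v j)|)].
Proof.
elim: N v => [|N IH] v /=.
  rewrite !big_ord0; split.
  - exact: compact_set1.
  - by apply/convex_setP => _ _ t _ -> ->; rewrite /= !scaler0 addr0.
  - by move=> u _ ->; rewrite big_ord0 dotvC dotv0l.
  - by move=> u; exists 0 => //; rewrite big_ord0 dotvC dotv0l.
have [cP vP uP aP] := IH (fun j => v (lift ord0 j)).
rewrite !big_ord_recl; split.
- exact: compact_minkowski_sum (compact_segment _) cP.
- exact: convex_minkowski_sum (convex_segment _) vP.
- move=> u _ [_ [t + <-] [z Pz <-]]; rewrite big_ord_recl dotvDr dotvZr.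
  rewrite /= in_itv/= => t1; apply: lerD; last exact: uP.
  apply: (le_trans (ler_norm _)); rewrite normrM ler_piMl//.
  by rewrite ler_norml.
- move=> u; have [p Pp pE] := aP u; rewrite big_ord_recl.
  exists (Num.sg (dotv u (v ord0)) *: v ord0 + p).
    exists (Num.sg (dotv u (v ord0)) *: v ord0); last by exists p.
    exists (Num.sg (dotv u (v ord0))) => //=; rewrite in_itv/= -ler_norml.
    by rewrite normr_sg lern1 leq_b1.
  by rewrite dotvDr dotvZr pE -normrEsg.
Qed.

(* On the unit sphere, [h] is a uniform limit of support functions of
   zonotopes. *)
Definition zonal (h : 'rV[R]_n -> R) := forall e, 0 < e ->
  exists s : seq 'rV[R]_n,
    forall u, `|h u - \sum_(v <- s) `|dotv u v| | <= e * enorm u.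

(** Compact convex sets whose support functions differ by at most e |u| lie in the e-neighbourhoods
    of each other, by [mem_minkowski_sum_ball] used in both directions; so [zonal] controls the
    Hausdorff distance. *)
Lemma zonoid_of_support_function K h : convex_body K -> zonal h ->
  (forall u y, K y -> dotv u y <= h u) ->
  (forall u, exists2 y, K y & dotv u y = h u) ->
  zonoid K.
Proof.
move=> bK zh upK attK; split=> //.
have [cK vK _ _] := bK.
have K0 : K !=set0 by have [y Ky _] := attK 0; exists y.
pose e k : R := k.+1%:R^-1.
have e0 k : 0 < e k by rewrite invr_gt0.
pose s k := projT1 (cid (zh _ (e0 k))).
pose v k (j : 'I_(size (s k))) := tnth (in_tuple (s k)) j.
have vP k u : `|h u - \sum_j `|dotv u (v k j)| | <= e k * enorm u.
  have := projT2 (cid (zh _ (e0 k))) u; rewrite -/(s k).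
  by rewrite (big_tnth _ _ (s k)).
pose P k := \big[@minkowski_sum R n/[set 0]]_(j < size (s k)) segment (v k j).
exists P; split; first by move=> k; exists (size (s k)), (v k).
have close k : [set e | [/\ 0 <= e,
    P k `<=` minkowski_sum K (dilate e (@euclidean_ball R n)) &
    K `<=` minkowski_sum (P k) (dilate e (@euclidean_ball R n))]] (e k).
  have [cP vP' uP aP] := zonotopeP _ (v k).
  split; first exact: ltW.
  - move=> y Py; apply: mem_minkowski_sum_ball => //; first exact: ltW.
    move=> u; have [z Kz zE] := attK u; exists z => //; rewrite zE.
    have := vP k u; rewrite ler_norml => /andP[+ _].
    by have := uP u _ Py; lra.
  - move=> y Ky; apply: mem_minkowski_sum_ball => //; last 1 first.
    + move=> u; have [z Pz zE] := aP u; exists z => //; rewrite zE.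
      have := vP k u; rewrite ler_norml => /andP[_ +].
      by have := upK u _ Ky; lra.
    + by have [p Pp _] := aP 0; exists p.
    + exact: ltW.
apply: (@squeeze_cvgr _ _ _ _ (cst 0) e).
- apply: nearW => k; apply/andP; split.
    apply: lb_le_inf; first by exists (e k); exact: close.
    by move=> x [].
  by apply: ge_inf; [by exists 0 => x []|exact: close].
- exact: cvg_cst.
- exact: cvg_harmonic.
Qed.

Lemma continuous_enorm : continuous enorm.
Proof.
move=> x; apply: continuous_comp; last exact: sqrt_continuous.
apply: continuous_sum => i {}x.
by apply: continuousM; exact: coord_continuous.
Qed.

Lemma enorm_bounded K (M : R) : (forall y, K y -> enorm y <= M) -> bounded_set K.
Proof.
move=> KM; exists `|M|; split; first by rewrite num_real.
move=> B MB y Ky; apply: (@le_trans _ _ `|M|); last exact: ltW.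
rewrite [leLHS]/Num.norm/= mx_normrE; apply/bigmax_leP; split=> // -[i j] _ /=.
rewrite (ord1 i); apply: (le_trans (enorm_coord _ _)).
exact: (le_trans (KM _ Ky) (ler_norm _)).
Qed.

(* [M] plays the role of the norm dual to [N]; neither is assumed to be
   convex, this follows from the attained duality. *)
Definition dual_pair (N M : 'rV[R]_n -> R) :=
  [/\ forall u y, dotv u y <= N u * M y,
      forall u, exists2 y, M y <= 1 & dotv u y = N u &
      forall y, exists2 u, N u <= 1 & dotv u y = M y].

Lemma dual_pair_sym N M : dual_pair N M -> dual_pair M N.
Proof.
move=> [H1 H2 H3]; split=> [y u|y|u].
- by rewrite dotvC mulrC.
- by have [u ? <-] := H3 y; exists u => //; rewrite dotvC.
- by have [y ? <-] := H2 u; exists y => //; rewrite dotvC.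
Qed.

Section unit_balls.
Variables (N M : 'rV[R]_n -> R) (c : R).
Hypotheses (NM : dual_pair N M) (c0 : 0 < c)
  (cN : forall u, c * enorm u <= N u) (cM : forall y, c * enorm y <= M y)
  (evenN : forall u, N (- u) = N u).

Let N_ge0 u : 0 <= N u.
Proof. by apply: le_trans (cN u); rewrite mulr_ge0 ?enorm_ge0// ltW. Qed.

Let dotv_le y u : M y <= 1 -> dotv u y <= N u.
Proof.
by have [H1 _ _] := NM => My; apply: (le_trans (H1 u y)); rewrite ler_piMr.
Qed.

(** The ball becomes an intersection of closed half-spaces, from which its closedness and convexity
    follow without convexity of [M]. *)
Lemma dual_unit_ballE : [set y | M y <= 1] = [set y | forall u, dotv u y <= N u].
Proof.
have [_ _ H3] := NM; apply/seteqP; split=> y /= My; first by move=> u; exact: dotv_le.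
by have [u Nu <-] := H3 y; exact: le_trans (My u) Nu.
Qed.

Lemma support_function_dual_ball u : support_function [set y | M y <= 1] u = N u.
Proof.
have [_ H2 _] := NM; rewrite /support_function; have [y My yE] := H2 u.
apply/le_anti/andP; split.
  apply: ge_sup; last by move=> _ [z /= Mz <-]; exact: dotv_le.
  by exists (dotv u y), y.
rewrite -yE; apply: ub_le_sup; last by exists y.
by exists (N u) => _ [z /= Mz <-]; exact: dotv_le.
Qed.

Lemma polar_dual_ball : polar [set y | M y <= 1] = [set u | N u <= 1].
Proof.
by apply/seteqP; split=> u; rewrite /polar/= support_function_dual_ball.
Qed.

(** [cM] bounds the ball; [cN] and Cauchy-Schwarz put the open Euclidean ball of radius [c] inside
    it, which gives an interior point. *)
Lemma convex_body_dual_ball : convex_body [set y | M y <= 1].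
Proof.
have [H1 H2 H3] := NM.
split.
- apply: bounded_closed_compact.
    apply: (@enorm_bounded _ c^-1) => y /= My.
    by rewrite -[c^-1]mul1r ler_pdivlMr// mulrC; exact: le_trans (cM y) My.
  rewrite dual_unit_ballE.
  have -> : [set y | forall u, dotv u y <= N u] =
      \bigcap_(u in [set: 'rV[R]_n]) ((fun y => dotv u y) @^-1` [set t | t <= N u]).
    by apply/seteqP; split=> y /= H u => [_|]; exact: H.
  apply: closed_bigI => u _; apply: preimage_closed; last exact: closed_le.
  by move=> y _; exact: continuous_dotv.
- rewrite dual_unit_ballE; apply/convex_setP => x y t /andP[t0 t1] /= Hx Hy u.
  have := Hx u; have := Hy u; rewrite dotvDr !dotvZr => A B.
  apply: (@le_trans _ _ (t * N u + (1 - t) * N u)); last first.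
    by rewrite -mulrDl addrC subrK mul1r.
  by apply: lerD; apply: ler_wpM2l => //; rewrite subr_ge0.
- rewrite dual_unit_ballE => x /= Hx u.
  by rewrite dotvNr -dotvNl -(evenN u); exact: Hx.
- exists 0; rewrite dual_unit_ballE.
  have : nbhs (0 : 'rV[R]_n) (enorm @^-1` [set t | t < c]).
    apply: continuous_enorm; rewrite enorm0.
    by apply: lt_nbhsl.
  apply: filterS => y /= yc u.
  apply: (le_trans (ler_norm _)); apply: (le_trans (cauchy_schwarz _ _)).
  by rewrite mulrC; apply: le_trans (cN u); rewrite ler_wpM2r ?enorm_ge0// ltW.
Qed.

Lemma zonoid_dual_ball : zonal N -> zonoid [set y | M y <= 1].
Proof.
move=> zN; apply: (zonoid_of_support_function _ N) => //.
- exact: convex_body_dual_ball.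
- by rewrite dual_unit_ballE => u y; exact.
- by have [_ H2 _] := NM.
Qed.

End unit_balls.

(* The parallelogram law for the Euclidean structure transported by [T] turns
   the failure of the law for [M] into distortion. *)
Lemma banach_mazur_ball_ge (M : 'rV[R]_n -> R) (c C : R) (p q : 'rV[R]_n) (b : R) :
  0 < c -> 0 < C -> (forall y, c * enorm y <= M y) -> (forall y, M y <= C * enorm y) ->
  (forall t y, 0 <= t -> M (t *: y) = t * M y) ->
  0 <= b ->
  b ^+ 2 * (M p ^+ 2 + M q ^+ 2) *+ 2 <= M (p + q) ^+ 2 + M (p - q) ^+ 2 ->
  p != 0 ->
  b <= banach_mazur [set y | M y <= 1] (@euclidean_ball R n).
Proof.
move=> c0 C0 cM MC homM b0 bM p0; apply: lb_le_inf.
  (* [lb_le_inf] asks for a nonempty set: the scalar matrix [C] sends the ball of [M] between the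
     Euclidean ball and its dilate by C / c. *)
  exists (Num.max 1 (C / c)); split; first by rewrite le_max lexx.
  exists C%:M; split.
  - by rewrite unitmxE det_scalar unitfE expf_neq0// gt_eqF.
  - move=> w /=; rewrite /euclidean_ball/= => w1; exists (C^-1 *: w).
      rewrite /=; apply: (le_trans (MC _)); rewrite enormZ ger0_norm ?invr_ge0 ?(ltW C0)//.
      by rewrite mulrA divff ?mul1r ?gt_eqF//.
    by rewrite mul_mx_scalar scalerA divff ?scale1r ?gt_eqF//.
  - move=> _ [x /= Mx <-]; rewrite mul_mx_scalar.
    have m0 : 0 < Num.max 1 (C / c) by rewrite lt_max ltr01.
    exists ((Num.max 1 (C / c))^-1 *: (C *: x)); last first.
      by rewrite scalerA divff ?scale1r ?gt_eqF//.
    rewrite /euclidean_ball/= !enormZ ger0_norm ?invr_ge0 ?(ltW m0)// mulrC.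
    rewrite ler_pdivrMr// mul1r le_max; apply/orP; right.
    rewrite ger0_norm ?(ltW C0)// ler_pM2l// -[leRHS]mul1r ler_pdivlMr// mulrC.
    exact: le_trans (cM x) Mx.
move=> a [a1 [T [uT T1 T2]]].
have a0 : 0 < a by exact: lt_le_trans a1.
have Mge0 y : 0 <= M y.
  by apply: le_trans (cM y); rewrite mulr_ge0 ?enorm_ge0// ltW.
have enorm_eq0 y : enorm y = 0 -> y = 0.
  by move=> y0; apply: dotv_eq0; rewrite -sqr_enorm y0 expr0n.
have Mgt0 y : y != 0 -> 0 < M y.
  move=> y0; apply: lt_le_trans (cM y); rewrite mulr_gt0// lt_def enorm_ge0 andbT.
  by apply: contra_neq y0; exact: enorm_eq0.
(* By homogeneity the two inclusions become M y <= |y T| <= a M y, so that the exact law [para] for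
   |y T| can be compared with the failing one for [M]. *)
have lo y : M y <= enorm (y *m T).
  have [->|y0] := eqVneq y 0; first by rewrite -(scale0r 0) homM// mul0r enorm_ge0.
  have yT0 : 0 < enorm (y *m T).
    rewrite lt_def enorm_ge0 andbT; apply: contra_neq y0 => /enorm_eq0 yT.
    by rewrite -(mulmxK uT y) yT mul0mx.
  have [|x /= Mx xT] := T1 ((enorm (y *m T))^-1 *: (y *m T)).
    rewrite /euclidean_ball/= enormZ ger0_norm ?invr_ge0 ?(ltW yT0)//.
    by rewrite mulVf ?gt_eqF.
  have yE : y = enorm (y *m T) *: x.
    rewrite -[in RHS](mulmxK uT x) xT -scalemxAl scalerA divff ?gt_eqF//.
    by rewrite scale1r mulmxK.
  by rewrite {1}yE homM ?enorm_ge0// ler_piMr// ltW.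
have hi y : enorm (y *m T) <= a * M y.
  have [->|y0] := eqVneq y 0; first by rewrite mul0mx enorm0 mulr_ge0// ltW.
  have My := Mgt0 _ y0.
  have [|w w1 wE] := T2 ((M y)^-1 *: (y *m T)).
    exists ((M y)^-1 *: y); last by rewrite scalemxAl.
    by rewrite /= homM ?invr_ge0 ?(ltW My)// mulVf ?gt_eqF.
  have -> : y *m T = M y *: (a *: w).
    by rewrite wE scalerA divff ?scale1r ?gt_eqF//.
  rewrite !enormZ !ger0_norm ?(ltW My) ?(ltW a0)// mulrA (mulrC a) ler_piMr// mulr_ge0//.
  exact: ltW.
have para : enorm ((p + q) *m T) ^+ 2 + enorm ((p - q) *m T) ^+ 2 =
    (enorm (p *m T) ^+ 2 + enorm (q *m T) ^+ 2) *+ 2.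
  rewrite mulmxBl mulmxDl; move: (p *m T) (q *m T) => P Q.
  rewrite !sqr_enorm !(dotvDl, dotvDr, dotvNl, dotvNr) (dotvC Q P) mulr2n.
  by ring.
have sq (x y : R) : 0 <= x -> x <= y -> x ^+ 2 <= y ^+ 2.
  by move=> x0 xy; rewrite ler_pXn2r// nnegrE// (le_trans x0).
have L1 := sq _ _ (Mge0 _) (lo (p + q)); have L2 := sq _ _ (Mge0 _) (lo (p - q)).
have U1 := sq _ _ (enorm_ge0 _) (hi p); have U2 := sq _ _ (enorm_ge0 _) (hi q).
rewrite !exprMn in U1 U2.
rewrite mulr2n in para bM.
have Mp : 0 < M p ^+ 2 + M q ^+ 2.
  by apply: ltr_pwDl; [rewrite exprn_gt0// Mgt0|exact: sqr_ge0].
have : b ^+ 2 * (M p ^+ 2 + M q ^+ 2) <= a ^+ 2 * (M p ^+ 2 + M q ^+ 2).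
  by rewrite mulrDr in bM *; lra.
by rewrite ler_pM2r// ler_pXn2r// nnegrE// ltW.
Qed.

End Euclidean.

(** * Completely monotone and Bernstein functions *)

Section completely_monotone_theory.
Context {R : realType}.
Implicit Types (f g h psi : R -> R) (a b z : R).

(* By Bernstein's theorem these are the completely monotone functions on the
   half-line; only the values at [0 <= z] are constrained. *)
Inductive completely_monotone : (R -> R) -> Prop :=
| cm_exp a b : 0 <= a -> 0 <= b -> completely_monotone (fun z => a * expR (- (b * z)))
| cm_add g h : completely_monotone g -> completely_monotone h ->
    completely_monotone (fun z => g z + h z)
| cm_lim (g_ : nat -> R -> R) g : (forall k, completely_monotone (g_ k)) ->
    (forall z, 0 <= z -> g_ k z @[k --> \oo] --> g z) -> completely_monotone g.

Local Notation CM := completely_monotone.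

(** The limit constructor, applied to a constant sequence, makes the class insensitive to values at
    negative arguments. *)
Lemma cm_ext g h : CM g -> (forall z, 0 <= z -> g z = h z) -> CM h.
Proof.
move=> cg gh; apply: (cm_lim (fun=> g)) => // z z0.
by rewrite gh//; exact: cvg_cst.
Qed.

Lemma cm_ge0 g : CM g -> forall z, 0 <= z -> 0 <= g z.
Proof.
elim=> [a b a0 b0 z z0|{}g h _ IHg _ IHh z z0|g_ {}g _ IH gg z z0].
- by rewrite mulr_ge0// expR_ge0.
- by rewrite addr_ge0 ?IHg ?IHh.
- by apply: (cvgr_to_ge (gg _ z0)); apply: nearW => k; exact: IH.
Qed.

Lemma cm_le0 g : CM g -> forall z, 0 <= z -> g z <= g 0.
Proof.
elim=> [a b a0 b0 z z0|{}g h _ IHg _ IHh z z0|g_ {}g _ IH gg z z0].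
- by rewrite ler_wpM2l// ler_expR mulr0 oppr0 oppr_le0 mulr_ge0.
- by rewrite lerD ?IHg ?IHh.
- by apply: (ler_cvg_to (gg _ z0) (gg 0 (lexx _))); apply: nearW => k; exact: IH.
Qed.

Lemma cm_cst a : 0 <= a -> CM (fun=> a).
Proof.
move=> a0; apply: (cm_ext _ _ (cm_exp a 0 a0 (lexx _))) => z _.
by rewrite mul0r oppr0 expR0 mulr1.
Qed.

(** Induction on both factors: products of exponentials are exponentials, and multiplication
    commutes with sums and pointwise limits. *)
Lemma cm_mul g h : CM g -> CM h -> CM (fun z => g z * h z).
Proof.
move=> cg ch; elim: cg => [a b a0 b0|{}g1 g2 _ IH1 _ IH2|g_ {}g _ IH gg].
- elim: ch => [a' b' a'0 b'0|h1 h2 _ IH1 _ IH2|h_ {}h _ IH hh].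
  + apply: (cm_ext _ _ (cm_exp (a * a') (b + b') _ _)); rewrite ?mulr_ge0 ?addr_ge0//.
    by move=> z _; rewrite mulrACA -expRD mulrDl opprD.
  + by apply: (cm_ext _ _ (cm_add _ _ IH1 IH2)) => z _; rewrite mulrDr.
  + by apply: (cm_lim _ _ IH) => z z0; apply: cvgMl_tmp; exact: hh.
- by apply: (cm_ext _ _ (cm_add _ _ IH1 IH2)) => z _; rewrite mulrDl.
- by apply: (cm_lim _ _ IH) => z z0; apply: cvgMr_tmp; exact: gg.
Qed.

Lemma cm_exprn g n : CM g -> CM (fun z => g z ^+ n).
Proof.
move=> cg; elim: n => [|n IH]; first exact: cm_cst.
by apply: (cm_ext _ _ (cm_mul _ _ cg IH)) => z _; rewrite exprS.
Qed.

Lemma cm_sum n (g_ : nat -> R -> R) :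
  (forall i, CM (g_ i)) -> CM (fun z => \sum_(0 <= i < n) g_ i z).
Proof.
move=> cg; elim: n => [|n IH].
  by apply: (cm_ext _ _ (cm_cst 0 (lexx _))) => z _; rewrite big_nil.
by apply: (cm_ext _ _ (cm_add _ _ IH (cg n))) => z _; rewrite big_nat_recr.
Qed.

Lemma cm_expR g : CM g -> CM (fun z => expR (g z)).
Proof.
move=> cg; apply: (cm_lim (fun n z => \sum_(0 <= i < n) ((i`!%:R)^-1 * g z ^+ i))).
  move=> n; apply: (cm_sum n (fun i z => (i`!%:R)^-1 * g z ^+ i)) => i.
  by apply: (cm_mul (fun=> _)); [apply: cm_cst; rewrite invr_ge0|exact: cm_exprn].
move=> z z0; have := @is_cvg_series_exp_coeff R (g z).
rewrite /expR; apply: cvg_trans; apply: near_eq_cvg; near=> n.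
by rewrite /series/=; apply: eq_bigr => i _; rewrite /exp_coeff/= mulrC.
Unshelve. all: by end_near. Qed.

Lemma cm_inv_1B g : CM g -> (forall z, 0 <= z -> g z < 1) -> CM (fun z => (1 - g z)^-1).
Proof.
move=> cg g1; apply: (cm_lim (fun n z => \sum_(0 <= i < n) g z ^+ i)).
  by move=> n; apply: (cm_sum n (fun i z => g z ^+ i)) => i; exact: cm_exprn.
move=> z z0; have := @cvg_geometric_series R 1 (g z).
rewrite mul1r ger0_norm ?cm_ge0// => /(_ (g1 _ z0)).
apply: cvg_trans; apply: near_eq_cvg; near=> n.
by rewrite /series/=; apply: eq_bigr => i _; rewrite mul1r.
Unshelve. all: by end_near. Qed.

(* By Bernstein's theorem these are the Bernstein functions, up to an additive
   real constant. *)
Definition bernstein psi := forall a, 0 <= a -> CM (fun z => expR (- (a * psi z))).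

Lemma bernstein_ext psi phi : bernstein psi -> (forall z, 0 <= z -> psi z = phi z) ->
  bernstein phi.
Proof. by move=> H E a a0; apply: cm_ext (H a a0) _ => z z0; rewrite E. Qed.

Lemma bernstein_affine b a : 0 <= b -> bernstein (fun z => b * z + a).
Proof.
move=> b0 c c0.
apply: (cm_ext _ _ (cm_exp (expR (- (c * a))) (c * b) _ _)).
- exact: expR_ge0.
- exact: mulr_ge0.
- by move=> z _; rewrite -expRD mulrDr opprD mulrA addrC.
Qed.

Lemma bernsteinD psi phi : bernstein psi -> bernstein phi ->
  bernstein (fun z => psi z + phi z).
Proof.
move=> H1 H2 a a0; apply: (cm_ext _ _ (cm_mul _ _ (H1 a a0) (H2 a a0))) => z _.
by rewrite -expRD mulrDr opprD.
Qed.

Lemma bernsteinZ b psi : 0 <= b -> bernstein psi -> bernstein (fun z => b * psi z).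
Proof.
move=> b0 H a a0; apply: cm_ext (H (a * b) _) _; first exact: mulr_ge0.
by move=> z _; rewrite mulrA.
Qed.

Lemma bernstein_sum n (p_ : nat -> R -> R) :
  (forall i, bernstein (p_ i)) -> bernstein (fun z => \sum_(0 <= i < n) p_ i z).
Proof.
move=> H; elim: n => [|n IH].
  apply: (bernstein_ext _ _ (bernstein_affine 0 0 (lexx _))) => z _.
  by rewrite mul0r addr0 big_nil.
by apply: (bernstein_ext _ _ (bernsteinD _ _ IH (H n))) => z _; rewrite big_nat_recr.
Qed.

Lemma bernstein_lim (p_ : nat -> R -> R) psi : (forall k, bernstein (p_ k)) ->
  (forall z, 0 <= z -> p_ k z @[k --> \oo] --> psi z) -> bernstein psi.
Proof.
move=> H L a a0; apply: (cm_lim _ _ (fun k => H k a a0)) => z z0.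
apply: continuous_cvg; first exact: continuous_expR.
by apply: cvgN; apply: cvgMl_tmp; exact: L.
Qed.

(** Here exp (- a (1 - g)) = exp (- a) exp (a g), and the exponential series has nonnegative
    coefficients. *)
Lemma bernstein_1B g : CM g -> bernstein (fun z => 1 - g z).
Proof.
move=> cg a a0.
apply: (cm_ext _ _ (cm_mul _ _ (cm_cst (expR (- a)) (expR_ge0 _))
  (cm_expR _ (cm_mul _ _ (cm_cst a a0) cg)))) => z _.
by rewrite -expRD mulrBr mulr1 opprB addrC.
Qed.

(** The integral of exp (- a psi) over a >= 0 is 1 / psi. Its Riemann sum of mesh t is a geometric
    series of value t / (1 - exp (- t psi)), which tends to 1 / psi with t. *)
Lemma cm_inv psi : bernstein psi -> (forall z, 0 <= z -> 0 < psi z) ->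
  CM (fun z => (psi z)^-1).
Proof.
move=> H psi0.
pose t k : R := k.+1%:R^-1.
have t0 k : 0 < t k by rewrite invr_gt0.
have e1 k z : 0 <= z -> expR (- (t k * psi z)) < 1.
  by move=> z0; rewrite expR_lt1 oppr_lt0 mulr_gt0// psi0.
apply: (cm_lim (fun k z => t k * (1 - expR (- (t k * psi z)))^-1)).
  move=> k; apply: (cm_mul (fun=> _)); first exact/cm_cst/ltW.
  by apply: cm_inv_1B; [apply: H; exact: ltW|exact: e1].
move=> z z0; have p0 := psi0 _ z0.
(* Both bounds are 1 + x <= exp x, at x = - t psi and at x = t psi. *)
apply: (@squeeze_cvgr _ _ _ _ (cst (psi z)^-1) (fun k => expR (t k * psi z) * (psi z)^-1)).
- apply: nearW => k /=; have tp : 0 < t k * psi z by rewrite mulr_gt0.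
  have E1 := e1 k _ z0.
  apply/andP; split.
    rewrite ler_pdivlMr ?subr_gt0// mulrC ler_pdivrMr//.
    have := expR_ge1Dx (- (t k * psi z)); lra.
  rewrite ler_pdivrMr ?subr_gt0// mulrAC ler_pdivlMr//.
  rewrite mulrBr mulr1 -expRD subrr expR0.
  have := expR_ge1Dx (t k * psi z); lra.
- exact: cvg_cst.
- rewrite -[X in _ --> X]mul1r; apply: cvgMr_tmp.
  rewrite -expR0; apply: continuous_cvg; first exact: continuous_expR.
  rewrite -(mul0r (psi z)); apply: cvgMr_tmp; exact: cvg_harmonic.
Qed.

End completely_monotone_theory.

(** * Roots of Bernstein functions by log-periodic series *)

Section log_periodic.
Context {R : realType}.
Variables (p : nat) (rho : R).
Hypotheses (p2 : (2 <= p)%N) (rho1 : 1 < rho).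

Let rho0 : 0 < rho. Proof. exact: lt_trans rho1. Qed.
Let rhoV : 0 < rho^-1 < 1.
Proof. by rewrite invr_gt0 rho0 invf_lt1. Qed.

(** [up] holds the terms of index i >= 0 of a two-sided series; [dn w i] is its term of index - (i +
    1). *)
Let up w (i : nat) : R := rho^-1 ^+ i * (1 - expR (- ((rho ^+ p) ^+ i * w))).
Let dn w (i : nat) : R := rho ^+ i.+1 * (1 - expR (- ((rho^-1 ^+ p) ^+ i.+1 * w))).

(* The sum over all integers [i] of [rho ^- i * (1 - exp (- rho ^ (p i) * w))],
   which rescales exactly like [w ^ (1/p)] under [w |-> rho ^ p * w]. *)
Definition log_periodic w := limn (series (up w)) + limn (series (dn w)).

Let onem_expR_le (t : R) : 1 - expR (- t) <= t.
Proof. by have := expR_ge1Dx (- t); lra. Qed.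

Let onem_expR_ge0 (t : R) : 0 <= t -> 0 <= 1 - expR (- t).
Proof. by move=> t0; rewrite subr_ge0 expR_le1 oppr_le0. Qed.

Let up_ge0 w i : 0 <= w -> 0 <= up w i.
Proof.
move=> w0; rewrite mulr_ge0 ?exprn_ge0 ?invr_ge0 ?(ltW rho0)//.
by apply: onem_expR_ge0; rewrite mulr_ge0// !exprn_ge0// ltW.
Qed.

Let dn_ge0 w i : 0 <= w -> 0 <= dn w i.
Proof.
move=> w0; rewrite mulr_ge0 ?exprn_ge0 ?(ltW rho0)//.
by apply: onem_expR_ge0; rewrite mulr_ge0// !exprn_ge0// invr_ge0 ltW.
Qed.

Lemma is_cvg_up w : 0 <= w -> cvgn (series (up w)).
Proof.
move=> w0; apply: (@series_le_cvg _ _ (geometric 1 rho^-1)).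
- by move=> i; exact: up_ge0.
- by move=> i; rewrite /geometric/= mul1r exprn_ge0// invr_ge0 ltW.
- move=> i; rewrite /geometric/= mul1r ler_piMr ?exprn_ge0 ?invr_ge0 ?(ltW rho0)//.
- have /andP[r0 r1] := rhoV.
  by apply: is_cvg_geometric_series; rewrite ger0_norm// ltW.
Qed.

(** This is where p >= 2 enters: 1 - exp (- t) <= t bounds the term by w rho^((1 - p) (i + 1)), and
    1 - p <= -1. *)
Lemma is_cvg_dn w : 0 <= w -> cvgn (series (dn w)).
Proof.
move=> w0; have /andP[r0 r1] := rhoV.
apply: (@series_le_cvg _ _ (geometric w rho^-1)).
- by move=> i; exact: dn_ge0.
- by move=> i; rewrite /geometric/= mulr_ge0// exprn_ge0// ltW.
- move=> i; rewrite /geometric/=.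
  apply: (@le_trans _ _ (rho ^+ i.+1 * ((rho^-1 ^+ p) ^+ i.+1 * w))).
    by rewrite ler_wpM2l ?exprn_ge0 ?(ltW rho0)// onem_expR_le.
  rewrite mulrA [leRHS]mulrC ler_wpM2r// -exprMn.
  have q1 : rho * rho^-1 ^+ p <= rho^-1.
    rewrite -(subnKC p2) exprD expr2 !mulrA divff ?gt_eqF// mul1r.
    by rewrite ler_piMr ?(ltW r0)// exprn_ile1 ?(ltW r0) ?(ltW r1).
  apply: (@le_trans _ _ (rho^-1 ^+ i.+1)).
    by rewrite lerXn2r ?nnegrE ?mulr_ge0 ?exprn_ge0 ?(ltW r0) ?(ltW rho0).
  by rewrite exprS ler_piMl ?exprn_ge0 ?(ltW r0) ?(ltW r1).
- by apply: is_cvg_geometric_series; rewrite ger0_norm// ltW.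
Qed.

Lemma log_periodic_scale w : 0 <= w -> log_periodic (rho ^+ p * w) = rho * log_periodic w.
Proof.
move=> w0; have rw0 : 0 <= rho ^+ p * w by rewrite mulr_ge0// exprn_ge0// ltW.
have rn0 : rho != 0 by rewrite gt_eqF.
(* Scaling shifts the index of the two-sided series by one, so the term of index 0, [g0], passes
   from [up] to [dn]. *)
pose g0 := 1 - expR (- w).
have uE n : series (up (rho ^+ p * w)) n = rho * (series (up w) n.+1 - g0).
  rewrite /series/= big_nat_recl// /up expr0 mul1r expr0 mul1r -/g0 [g0 + _]addrC addrK.
  rewrite mulr_sumr; apply: eq_bigr => i _.
  by rewrite exprS !mulrA divff// mul1r exprSr.
have dE n : series (dn (rho ^+ p * w)) n.+1 = rho * (series (dn w) n + g0).
  rewrite /series/= big_nat_recl// {1}/dn expr1 expr1 mulrA -exprMn mulVf//.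
  rewrite expr1n mul1r -/g0 [in RHS]mulrDr addrC; congr (_ + _).
  rewrite mulr_sumr; apply: eq_bigr => i _; rewrite /dn.
  rewrite [rho ^+ i.+2]exprS -mulrA; congr (_ * (_ * _)).
  congr (1 - expR (- _)).
  by rewrite exprSr -mulrA; congr (_ * _); rewrite mulrA -exprMn mulVf// expr1n mul1r.
have L1 : limn (series (up (rho ^+ p * w))) = rho * (limn (series (up w)) - g0).
  apply/cvg_lim => //; rewrite (eq_cvg _ _ uE).
  apply: cvgMl_tmp; apply: cvgB; last exact: cvg_cst.
  by rewrite (cvg_shiftS (series (up w))); exact: is_cvg_up.
have L2 : limn (series (dn (rho ^+ p * w))) = rho * (limn (series (dn w)) + g0).
  apply/cvg_lim => //; rewrite -cvg_shiftS (eq_cvg _ _ dE).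
  apply: cvgMl_tmp; apply: cvgD; last exact: cvg_cst.
  exact: is_cvg_dn.
by rewrite /log_periodic L1 L2; ring.
Qed.

Lemma log_periodic_scaleX j w : 0 <= w ->
  log_periodic ((rho ^+ p) ^+ j * w) = rho ^+ j * log_periodic w.
Proof.
move=> w0; elim: j => [|j IH]; first by rewrite !expr0 !mul1r.
by rewrite !exprS -mulrA log_periodic_scale ?IH ?mulrA// mulr_ge0// !exprn_ge0// ltW.
Qed.

Lemma log_periodic_le w w' : 0 <= w -> w <= w' -> log_periodic w <= log_periodic w'.
Proof.
move=> w0 ww'; have w'0 : 0 <= w' by exact: le_trans ww'.
have mono (c : R) : 0 <= c -> 1 - expR (- (c * w)) <= 1 - expR (- (c * w')).
  by move=> c0; rewrite lerB// ler_expR lerN2 ler_wpM2l.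
apply: lerD; apply: ler_lim.
- exact: is_cvg_up.
- exact: is_cvg_up.
- apply: nearW => n; apply: ler_sum => i _.
  rewrite ler_wpM2l ?exprn_ge0 ?invr_ge0 ?(ltW rho0)//; apply: mono.
  by rewrite !exprn_ge0// ltW.
- exact: is_cvg_dn.
- exact: is_cvg_dn.
- apply: nearW => n; apply: ler_sum => i _.
  rewrite ler_wpM2l ?exprn_ge0 ?(ltW rho0)//; apply: mono.
  by rewrite !exprn_ge0// invr_ge0 ltW.
Qed.

Lemma log_periodic1_gt0 : 0 < log_periodic 1.
Proof.
apply: (@lt_le_trans _ _ (1 - expR (- 1))).
  by rewrite subr_gt0 expR_lt1 oppr_lt0.
rewrite -[leLHS]addr0; apply: lerD.
  apply: limr_ge; first exact: is_cvg_up.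
  near=> n; have -> : n = n.-1.+1 by rewrite prednK//; near: n; exact: nbhs_infty_gt.
  rewrite /series/= big_nat_recl// /up expr0 mul1r expr0 mul1r lerDl.
  by apply: sumr_ge0 => i _; exact: up_ge0.
apply: limr_ge; first exact: is_cvg_dn.
by apply: nearW => n; apply: sumr_ge0 => i _; exact: dn_ge0.
Unshelve. all: by end_near. Qed.

(** By [log_periodic_scaleX] the ratio is exactly rho^j at w = rho^(p j). By monotonicity it lies,
    like r, between two consecutive powers of rho; [1 <= r] keeps j natural. *)
Lemma log_periodic_root w r : 1 <= r -> r ^+ p = w ->
  `|log_periodic w / log_periodic 1 - r| <= r * (rho - 1).
Proof.
move=> r1 rw; have r0 : 0 < r by exact: lt_le_trans r1.
have [j0 j0P] : exists j, r < rho ^+ j.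
  have r10 : 0 < rho - 1 by rewrite subr_gt0.
  exists (Num.bound (r / (rho - 1))).
  have := archi_boundP (divr_ge0 (ltW r0) (ltW r10)).
  rewrite ltr_pdivrMr// => /lt_le_trans; apply.
  elim: (Num.bound _) => [|m IH]; first by rewrite mul0r expr0.
  rewrite -natr1 mulrDl mul1r exprS.
  have rm : 1 <= rho ^+ m by rewrite exprn_ege1// ltW.
  by nra.
case: (ex_minnP (ex_intro (fun j => r < rho ^+ j) j0 j0P)) => -[|j] jP jmin.
  by move: jP; rewrite expr0 ltNge r1.
have jr : rho ^+ j <= r.
  by rewrite leNgt; apply/negP => /jmin; rewrite ltnn.
have powXC (i : nat) : (rho ^+ p) ^+ i * 1 = (rho ^+ i) ^+ p.
  by rewrite mulr1 -!exprM mulnC.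
have lo : rho ^+ j * log_periodic 1 <= log_periodic w.
  rewrite -log_periodic_scaleX// powXC; apply: log_periodic_le.
    by rewrite !exprn_ge0 ?(ltW rho0).
  by rewrite -rw lerXn2r ?nnegrE ?exprn_ge0 ?(ltW rho0) ?(ltW r0) ?(ltW jP).
have hi : log_periodic w <= rho ^+ j.+1 * log_periodic 1.
  rewrite -log_periodic_scaleX// powXC; apply: log_periodic_le.
    by rewrite -rw exprn_ge0// ltW.
  by rewrite -rw lerXn2r ?nnegrE ?exprn_ge0 ?(ltW rho0) ?(ltW r0) ?(ltW jP).
have S0 := log_periodic1_gt0.
rewrite -ler_pdivlMr// in lo; rewrite -ler_pdivrMr// in hi.
move: lo hi; set q := _ / _ => lo hi.
rewrite exprS in hi jP.
have : (rho - 1) * rho ^+ j <= (rho - 1) * r by rewrite ler_pM2l ?subr_gt0.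
by rewrite ler_norml !mulrBl !mul1r => H; apply/andP; split; lra.
Qed.

Lemma bernstein_log_periodic (psi : R -> R) : bernstein psi ->
  (forall z, 0 <= z -> 0 <= psi z) -> bernstein (fun z => log_periodic (psi z)).
Proof.
move=> Hpsi psi0; apply: bernsteinD.
- apply: (bernstein_lim (fun n z => series (up (psi z)) n)) => [n|z z0]; last first.
    by apply: is_cvg_up; exact: psi0.
  apply: (bernstein_sum n (fun i z => up (psi z) i)) => i.
  apply: bernsteinZ; first by rewrite exprn_ge0// invr_ge0 ltW.
  by apply: bernstein_1B; apply: Hpsi; rewrite !exprn_ge0// ltW.
- apply: (bernstein_lim (fun n z => series (dn (psi z)) n)) => [n|z z0]; last first.
    by apply: is_cvg_dn; exact: psi0.
  apply: (bernstein_sum n (fun i z => dn (psi z) i)) => i.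
  apply: bernsteinZ; first by rewrite exprn_ge0// ltW.
  by apply: bernstein_1B; apply: Hpsi; rewrite !exprn_ge0// invr_ge0 ltW.
Qed.

End log_periodic.

(** Letting rho tend to 1 removes the oscillation: the relative error of the normalised series is at
    most rho - 1. *)
Lemma bernstein_root {R : realType} (p : nat) (psi r : R -> R) : (2 <= p)%N ->
  bernstein psi -> (forall z, 0 <= z -> 1 <= r z /\ r z ^+ p = psi z) -> bernstein r.
Proof.
move=> p2 Hpsi rP.
pose rho k : R := 1 + k.+1%:R^-1.
have rho1 k : 1 < rho k by rewrite ltrDl invr_gt0.
apply: (bernstein_lim (fun k z =>
  (log_periodic p (rho k) 1)^-1 * log_periodic p (rho k) (psi z))).
  move=> k; apply: bernsteinZ; first by rewrite invr_ge0 ltW// log_periodic1_gt0.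
  apply: bernstein_log_periodic => // z z0; have [r1 <-] := rP z z0.
  by rewrite exprn_ge0// (le_trans _ r1).
move=> z z0; have [r1 rE] := rP z z0.
apply/subr_cvg0; apply/norm_cvg0P.
apply: (@squeeze_cvgr _ _ _ _ (cst 0) (fun k => r z * k.+1%:R^-1)).
- apply: nearW => k; rewrite normr_ge0/= mulrC.
  have -> : k.+1%:R^-1 = rho k - 1 by rewrite /rho addrC addKr.
  exact: log_periodic_root.
- exact: cvg_cst.
- by rewrite -(mulr0 (r z)); apply: cvgMl_tmp; exact: cvg_harmonic.
Qed.

(* The map [w |-> (q + 3 w)^(1/3)] is Bernstein in both arguments, and a
   contraction towards the root of [w^3 - 3 w = q]. *)
Lemma bernstein_cubic {R : realType} (q w : R -> R) : bernstein q ->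
  (forall z, 0 <= z -> 2 <= q z) ->
  (forall z, 0 <= z -> 2 <= w z /\ w z ^+ 3 = q z + 3 * w z) -> bernstein w.
Proof.
move=> Hq q2 wP.
pose step (v : R -> R) z := powR (q z + 3 * v z) 3^-1.
pose W k := iter k step (fun=> 2).
(* The iteration preserves the bound 2 because q + 3 v >= 2 + 6 = 2^3. *)
have stepE v z : 0 <= z -> 2 <= v z -> 2 <= step v z /\ step v z ^+ 3 = q z + 3 * v z.
  move=> z0 v2; have q2' := q2 z z0.
  have pos : 0 <= q z + 3 * v z by lra.
  have E : step v z ^+ 3 = q z + 3 * v z.
    by rewrite -powR_mulrn ?powR_ge0// -powRrM mulVf// powRr1.
  split=> //; rewrite leNgt; apply/negP => s2.
  have s0 : 0 <= step v z by exact: powR_ge0.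
  have : step v z ^+ 3 < 2 ^+ 3 by rewrite ltrXn2r.
  by rewrite E; lra.
have W2 k z : 0 <= z -> 2 <= W k z.
  by move=> z0; elim: k => [|k IH] //; exact: (stepE _ _ z0 IH).1.
have HW k : bernstein (W k).
  elim: k => [|k IH].
    by apply: (bernstein_ext _ _ (bernstein_affine 0 2 (lexx _))) => z _; rewrite mul0r add0r.
  apply: (bernstein_root 3 (fun z => q z + 3 * W k z)) => //.
    by apply: bernsteinD => //; exact: bernsteinZ.
  move=> z z0; have [s2 sE] := stepE _ _ z0 (W2 k z z0).
  by split=> //; apply: le_trans s2; lra.
apply: bernstein_lim HW _ => z z0.
have [w2 wE] := wP z z0.
(* Subtracting cubes gives (s - w) (s^2 + s w + w^2) = 3 (v - w), whose second factor is at least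
   12; the ratio 1/4 is relaxed to 1/2. *)
have dist k : `|W k z - w z| <= `|2 - w z| * 2^-1 ^+ k.
  elim: k => [|k IH]; first by rewrite expr0 mulr1.
  have [s2 sE] := stepE _ _ z0 (W2 k z z0).
  rewrite exprSr mulrA; apply: le_trans (ler_wpM2r _ IH); last by rewrite invr_ge0.
  have -> : W k.+1 z = step (W k) z by [].
  set s := step _ _ in s2 sE *; set v := W k z in sE *.
  have E : `|s - w z| * (s ^+ 2 + s * w z + w z ^+ 2) = `|v - w z| * 3.
    rewrite -[3]ger0_norm// -normrM -[X in _ * X]ger0_norm; last by nra.
    rewrite -normrM; congr `|_|; transitivity (s ^+ 3 - w z ^+ 3); first by ring.
    by rewrite sE wE; ring.
  have : `|s - w z| * 12 <= `|v - w z| * 3 by rewrite -E ler_wpM2l//; nra.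
  by have := normr_ge0 (v - w z); lra.
apply/subr_cvg0; apply/norm_cvg0P.
apply: (@squeeze_cvgr _ _ _ _ (cst 0) (geometric `|2 - w z| 2^-1)).
- by apply: nearW => k; rewrite normr_ge0/=.
- exact: cvg_cst.
- by apply: cvg_geometric; rewrite ger0_norm ?invr_ge0// invf_lt1// ltr1n.
Qed.

(** * Gaussian integrals *)

Section gaussian_integrals.
Context {R : realType}.
Local Notation mu := (@lebesgue_measure R).
Local Notation halfline := [set` `[(0 : R), +oo[].

Lemma integralT_affine (a c : R) (G : R -> R) : 0 < a -> continuous G ->
  (forall x, 0 <= G x) ->
  (\int[mu]_x (G x)%:E = \int[mu]_x (G (a * x + c) * a)%:E)%E.
Proof.
move=> a0 cG G0; pose F x : R := a * x + c.
have dF (x : R) : is_derive x (1 : R) F a.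
  rewrite (_ : F = (cst a * id + cst c)); last by apply/funext.
  by apply: is_derive_eq; rewrite /= addr0 scaler0 addr0 scaler1.
have dFE : derive1 F = cst a.
  by apply/funext => x; rewrite derive1E; apply: derive_val.
rewrite (@increasing_ge0_integration_by_substitutionT _ F G)//.
- by apply: eq_integral => x _ /=; rewrite fctE dFE.
- by move=> x y xy; rewrite /F ltrD2r ltr_pM2l.
- by rewrite dFE; exact: cst_continuous.
- by rewrite dFE; exact: is_cvg_cst.
- by rewrite dFE; exact: is_cvg_cst.
- apply/cvgrNyPle => A; apply: filterS (nbhs_ninfty_le (num_real ((A - c) / a))) => x.
  by rewrite /F ler_pdivlMr// lerBrDr mulrC.
- apply/cvgryPge => A; apply: filterS (nbhs_pinfty_ge (num_real ((A - c) / a))) => x.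
  by rewrite /F ler_pdivrMr// lerBlDr mulrC.
Qed.

Lemma integralT_fold (h : R -> R) : continuous h -> (forall x, 0 <= h x) ->
  (\int[mu]_x (h x)%:E = \int[mu]_(x in halfline) (h x + h (- x))%:E)%E.
Proof.
move=> ch h0.
have mh : measurable_fun [set: R] h by exact: continuous_measurable_fun.
have mhN : measurable_fun [set: R] (fun x => h (- x)).
  by apply: measurableT_comp => //; exact: oppr_measurable.
rewrite -(setUv halfline) ge0_integral_setU//=; first last.
- exact/disj_setPCl.
- by move=> x _; rewrite lee_fin.
- by rewrite setUv; exact/measurable_EFinP.
- exact: measurableC.
rewrite setCitvr integral_itv_bndo_bndc; last exact/measurable_EFinP/measurable_funTS.
rewrite -{2}oppr0 ge0_integration_by_substitutionNy//; last exact: continuous_subspaceT.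
rewrite -ge0_integralD//=.
- by move=> x _; rewrite lee_fin.
- exact/measurable_EFinP/measurable_funTS.
- by move=> x _; rewrite lee_fin.
- exact/measurable_EFinP/measurable_funTS.
Qed.

Definition gaussian (b x : R) := expR (- (b * x ^+ 2)).

Lemma gaussian_ge0 b x : 0 <= gaussian b x.
Proof. exact: expR_ge0. Qed.

Lemma continuous_gaussian b : continuous (gaussian b).
Proof.
move=> x; apply: continuous_comp; last exact: continuous_expR.
apply: cvgN; apply: cvgMl_tmp; exact: exprn_continuous.
Qed.

Lemma integralT_gaussian b : 0 < b -> exists2 c, 0 < c &
  (\int[mu]_x (gaussian b x)%:E = c%:E)%E.
Proof.
move=> b0; exists (Num.sqrt pi * (Num.sqrt b)^-1).
  by rewrite mulr_gt0 ?invr_gt0 ?sqrtr_gt0// pi_gt0.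
have s0 : 0 < (Num.sqrt b)^-1 by rewrite invr_gt0 sqrtr_gt0.
rewrite (integralT_affine _ 0 _ s0 (continuous_gaussian b) (gaussian_ge0 b)).
under eq_integral do rewrite mulrC EFinM.
rewrite ge0_integralZl//=.
- rewrite EFinM [RHS]muleC; congr (_ * _)%E; rewrite -integralT_gauss.
  apply: eq_integral => x _; congr ((expR (- _))%:E).
  by rewrite addr0 exprMn exprVn sqr_sqrtr ?(ltW b0)// mulVKf// gt_eqF.
- apply/measurable_EFinP; apply: continuous_measurable_fun => x.
  apply: continuous_comp; last exact: continuous_gaussian.
  by apply: cvgD; [apply: cvgMl_tmp; exact: cvg_id|exact: cvg_cst].
- by move=> x _; rewrite lee_fin gaussian_ge0.
Qed.

(** The factor [1 + v] dominates [Num.max s (r * v)] up to the constant r + s, so [maxint] is finite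
    for every weight. *)
Definition weight (k : R -> R) :=
  [/\ measurable_fun halfline k, forall v, 0 <= v -> 0 <= k v &
      mu.-integrable halfline (fun v => ((1 + v) * k v)%:E)].

(** For nonnegative arguments the maximum is the mean of |s + r v| and |s - r v|: this is the
    support function of a planar zonoid symmetric in both axes. *)
Definition maxint (k : R -> R) (r s : R) :=
  \int[mu]_(v in halfline) (Num.max s (r * v) * k v).

Lemma halflineP (v : R) : halfline v <-> 0 <= v.
Proof. by rewrite /= in_itv/= andbT. Qed.

Lemma integrable_weight k (f : R -> R) C : weight k -> measurable_fun halfline f ->
  (forall v, 0 <= v -> `|f v| <= C * ((1 + v) * k v)) ->
  mu.-integrable halfline (EFin \o f).
Proof.
move=> [mk k0 ik] mf fC.
apply: (@le_integrable _ _ R mu halfline _ _ (fun v => (C%:E * ((1 + v) * k v)%:E)%E)) => //.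
- exact/measurable_EFinP.
- move=> v /halflineP v0; rewrite -EFinM !abse_EFin lee_fin.
  exact: le_trans (fC v v0) (ler_norm _).
- exact: integrableZl.
Qed.

Lemma measurable_maxr_weight k r s : measurable_fun halfline k ->
  measurable_fun halfline (fun v => Num.max s (r * v) * k v).
Proof.
move=> mk; apply: measurable_funM => //; exact: measurable_maxr.
Qed.

Lemma maxr_le_weight (r s v : R) : 0 <= r -> 0 <= s -> 0 <= v ->
  0 <= Num.max s (r * v) <= (r + s) * (1 + v).
Proof.
move=> r0 s0 v0; have rv := mulr_ge0 r0 v0; have sv := mulr_ge0 s0 v0.
by rewrite le_max s0/= ge_max; apply/andP; split; lra.
Qed.

Lemma integrable_maxint k r s : weight k -> 0 <= r -> 0 <= s ->
  mu.-integrable halfline (fun v => (Num.max s (r * v) * k v)%:E).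
Proof.
move=> wk r0 s0; have [mk k0 ik] := wk.
apply: (@integrable_weight k _ (r + s)) => //; first exact: measurable_maxr_weight.
move=> v v0; have /andP[m0 m1] := maxr_le_weight r s v r0 s0 v0.
by rewrite ger0_norm ?mulr_ge0 ?k0// mulrA ler_wpM2r// k0.
Qed.

Lemma EFin_maxint k r s : weight k -> 0 <= r -> 0 <= s ->
  (maxint k r s)%:E = (\int[mu]_(v in halfline) (Num.max s (r * v) * k v)%:E)%E.
Proof.
move=> wk r0 s0; rewrite fineK//; apply: integrable_fin_num => //.
exact: integrable_maxint.
Qed.

Lemma maxint_lipschitz k r s r' s' : weight k ->
  0 <= r -> 0 <= s -> 0 <= r' -> 0 <= s' ->
  `|maxint k r s - maxint k r' s'| <=
  (`|r - r'| + `|s - s'|) * \int[mu]_(v in halfline) ((1 + v) * k v).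
Proof.
move=> wk r0 s0 r'0 s'0; have [mk k0 ik] := wk.
have i1 := integrable_maxint k r s wk r0 s0.
have i2 := integrable_maxint k r' s' wk r'0 s'0.
have mD : measurable (halfline : set (measurableTypeR R)) by exact: measurable_itv.
have i12 : mu.-integrable halfline (EFin \o (fun v =>
    Num.max s (r * v) * k v - Num.max s' (r' * v) * k v)).
  exact: (integrableB mD i1 i2).
rewrite -RintegralB// -RintegralZl//.
apply: (le_trans (le_normr_Rintegral mD i12)).
apply: le_Rintegral => //.
- exact: (integrable_norm i12).
- exact: (integrableZl mD _ ik).
- move=> v /halflineP v0; rewrite -mulrBl normrM (ger0_norm (k0 _ v0)) mulrA.
  rewrite ler_wpM2r ?k0//.
  have h1 := ler_norm (r - r'); have h2 := ler_norm (s - s').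
  have h3 := ler_norm (- (r - r')); have h4 := ler_norm (- (s - s')).
  rewrite !normrN in h3 h4.
  have n1 := normr_ge0 (r - r'); have n2 := normr_ge0 (s - s').
  set A := `|r - r'| in h1 h3 n1 *; set B := `|s - s'| in h2 h4 n2 *.
  have Av : 0 <= A * v by exact: mulr_ge0.
  have Bv : 0 <= B * v by exact: mulr_ge0.
  have h5 : (r - r') * v <= A * v by exact: ler_wpM2r.
  have h6 : - (r - r') * v <= A * v by exact: ler_wpM2r.
  rewrite ler_norml.
  by have [] := lerP s (r * v); have [] := lerP s' (r' * v); lra.
Qed.

Lemma lipschitz_continuous (f : R -> R) K :
  (forall x y, `|f x - f y| <= K * `|x - y|) -> continuous f.
Proof.
move=> fK x; apply/cvgrPdist_le => e e0.
have K0 : 0 < `|K| + 1 by rewrite ltr_wpDl.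
near=> y; apply: (le_trans (fK x y)).
apply: (@le_trans _ _ ((`|K| + 1) * `|x - y|)).
  by rewrite ler_wpM2r// (le_trans (ler_norm K))// lerDl.
rewrite mulrC -ler_pdivlMr//; near: y.
by apply: cvgr_dist_le; [exact: cvg_id|rewrite divr_gt0].
Unshelve. all: by end_near. Qed.

Lemma continuous_maxint_affine k (q t a : R) : weight k -> 0 <= q ->
  continuous (fun v : R => maxint k q `|t + a * v|).
Proof.
move=> wk q0; have [_ k0 _] := wk.
pose I := \int[mu]_(v in halfline) ((1 + v) * k v).
have I0 : 0 <= I.
  by apply: Rintegral_ge0 => v /halflineP v0; rewrite mulr_ge0 ?k0// addr_ge0.
apply: (@lipschitz_continuous _ (`|a| * I)) => x y.
apply: le_trans (maxint_lipschitz _ _ _ _ _ wk q0 _ q0 _) _ => //.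
rewrite subrr normr0 add0r -/I mulrAC ler_wpM2r// -normrM.
by apply: le_trans (ler_dist_dist _ _) _; rewrite opprD addrACA subrr add0r -mulrBr.
Qed.

Lemma weight_gaussian b : 0 < b -> weight (gaussian b).
Proof.
move=> b0; have mg c : measurable_fun [set: R] (gaussian c).
  by apply: continuous_measurable_fun; exact: continuous_gaussian.
split=> [||].
- exact: measurable_funTS.
- by move=> v _; exact: gaussian_ge0.
have b20 : 0 < b / 2 by rewrite divr_gt0.
have [c c0 cE] := integralT_gaussian _ b20.
have ig : mu.-integrable halfline (EFin \o gaussian (b / 2)).
  apply: (@integrableS _ _ _ _ setT) => //.
  apply/integrableP; split; first by apply/measurable_EFinP; exact: mg.
  under eq_integral do rewrite /= ger0_norm ?gaussian_ge0//.
  by rewrite cE ltry.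
(* Half of the exponent absorbs the factor 1 + v, through 1 + v <= (1 + 1/b) (1 + b v^2 / 2), a
   consequence of (b v - 1)^2 >= 0, and 1 + x <= exp x. *)
apply: (@le_integrable _ _ R mu halfline _ _
  (fun v => ((1 + (2 * b)^-1 *+ 2)%:E * (gaussian (b / 2) v)%:E)%E)) => //.
- apply/measurable_EFinP; apply: measurable_funM; last by apply: measurable_funTS; exact: mg.
  exact: measurable_funD.
- move=> v /halflineP v0; rewrite -EFinM !abse_EFin lee_fin.
  apply: le_trans (ler_norm _).
  rewrite ger0_norm; last by rewrite mulr_ge0 ?gaussian_ge0// addr_ge0.
  have -> : gaussian b v = gaussian (b / 2) v * gaussian (b / 2) v.
    by rewrite /gaussian -expRD; congr expR; lra.
  rewrite mulrA ler_wpM2r ?gaussian_ge0// {1}/gaussian expRN.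
  rewrite ler_pdivrMr ?expR_gt0//.
  have E := expR_ge1Dx (b / 2 * v ^+ 2).
  set B := (2 * b)^-1 *+ 2.
  have B0 : 0 < B by rewrite mulrn_wgt0// invr_gt0 mulr_gt0.
  have Bb : B * b = 1.
    by rewrite /B mulr2n invfM; field; rewrite gt_eqF.
  apply: (@le_trans _ _ ((1 + B) * (1 + b / 2 * v ^+ 2))); last first.
    by rewrite ler_pM2l// addr_gt0.
  have bv : 0 <= b * v ^+ 2 by rewrite mulr_ge0 ?sqr_ge0// ltW.
  have -> : (1 + B) * (1 + b / 2 * v ^+ 2) =
      1 + B + b * v ^+ 2 / 2 + (B * b) * v ^+ 2 / 2 by field.
  have H : 0 <= B * (b * v - 1) ^+ 2 by rewrite mulr_ge0 ?sqr_ge0// ltW.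
  have HE : B * (b * v - 1) ^+ 2 = (B * b) * (b * v ^+ 2) - (B * b) * v *+ 2 + B.
    by rewrite mulr2n; ring.
  rewrite HE Bb !mul1r mulr2n in H; rewrite Bb mul1r.
  by have := sqr_ge0 v; lra.
- exact: integrableZl.
Qed.

(** Folding at 0 pairs |t + r v| with |t - r v|, whose sum is twice the maximum of |t| and |r| v for
    v >= 0. *)
Lemma integralT_abs_gaussian b (r t : R) : 0 < b ->
  (\int[mu]_v (`|t + r * v| * gaussian b v)%:E = (2 * maxint (gaussian b) `|r| `|t|)%:E)%E.
Proof.
move=> b0; have wb := weight_gaussian _ b0.
rewrite integralT_fold; first last.
- by move=> v; rewrite mulr_ge0 ?gaussian_ge0.
- move=> v; apply: cvgM; last exact: continuous_gaussian.
  apply: cvg_norm; apply: cvgD; first exact: cvg_cst.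
  by apply: cvgMl_tmp; exact: cvg_id.
rewrite EFinM EFin_maxint// -ge0_integralZl//=.
- apply: eq_integral => v /[!inE] /halflineP v0; rewrite -EFinM; congr EFin.
  rewrite /gaussian sqrrN -mulrDl [in RHS]mulrA; congr (_ * _).
  rewrite mulrN; have -> : `|r| * v = `|r * v| by rewrite normrM (ger0_norm v0).
  move: (r * v) => x.
  by have [] := lerP `|t| `|x|; have [] := ler0P (t + x); have [] := ler0P (t - x);
    have [] := ler0P t; have [] := ler0P x; lra.
- by apply/measurable_EFinP; apply: measurable_maxr_weight; case: wb.
- move=> v /halflineP v0; rewrite lee_fin mulr_ge0 ?gaussian_ge0//.
  by rewrite le_max normr_ge0.
Qed.

Lemma maxintZ (k : R -> R) r s a : weight k -> 0 <= r -> 0 <= s -> 0 <= a ->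
  maxint k (a * r) (a * s) = a * maxint k r s.
Proof.
move=> wk r0 s0 a0; rewrite /maxint -RintegralZl//; last exact: integrable_maxint.
by apply: eq_Rintegral => v _; rewrite -mulrA -maxr_pMr// mulrA.
Qed.

(* Convolution of two centred Gaussians, after completing the square. *)
Lemma maxint_gaussian_conv b : 0 < b -> exists2 c, 0 < c &
  forall q a t, 0 <= q ->
  (\int[mu]_v (maxint (gaussian b) q `|t + a * v| * gaussian b v)%:E =
   (c * maxint (gaussian b) (Num.sqrt (q ^+ 2 + a ^+ 2)) `|t|)%:E)%E.
Proof.
move=> b0; have [c c0 cE] := integralT_gaussian _ b0; exists c => // q a t.
(* The substitution below divides by [q]. For q = 0 the inner [maxint] is a multiple of |t + a v|,
   and [integralT_abs_gaussian] suffices. *)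
rewrite le_eqVlt => /predU1P[<-|q0].
  have cm : c = 2 * maxint (gaussian b) 0 1.
    apply: EFin_inj; rewrite -cE.
    have := integralT_abs_gaussian b 0 1 b0; rewrite normr0 normr1 => <-.
    by apply: eq_integral => v _; rewrite mul0r addr0 normr1 mul1r.
  have m0 s : 0 <= s -> maxint (gaussian b) 0 s = s * maxint (gaussian b) 0 1.
    move=> s0; rewrite -maxintZ//; first by rewrite mulr0 mulr1.
    exact: weight_gaussian.
  rewrite expr0n add0r sqrtr_sqr.
  have cg := continuous_gaussian b; have g0 := gaussian_ge0 b.
  have mI : 0 <= maxint (gaussian b) 0 1.
    by have := ltW c0; rewrite cm pmulr_rge0.
  under eq_integral do rewrite m0// mulrAC EFinM.
  rewrite ge0_integralZr//=.
  - by rewrite integralT_abs_gaussian// cm -EFinM mulrAC.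
  - apply/measurable_EFinP; apply: continuous_measurable_fun => v.
    apply: cvgM; last exact: cg; apply: cvg_norm.
    by apply: cvgD; [exact: cvg_cst|apply: cvgMl_tmp; exact: cvg_id].
  - by move=> v _; rewrite lee_fin mulr_ge0.
set rho := Num.sqrt _.
have rhoE : rho ^+ 2 = q ^+ 2 + a ^+ 2 by rewrite sqr_sqrtr// addr_ge0 ?sqr_ge0.
have rho0 : 0 < rho by rewrite sqrtr_gt0 ltr_wpDr ?sqr_ge0// exprn_gt0.
have rq0 : 0 < rho / q by rewrite divr_gt0.
have cg := continuous_gaussian b; have g0 := gaussian_ge0 b.
have clin (x y : R) : continuous (fun v => x + y * v).
  by move=> v; apply: cvgD; [exact: cvg_cst|apply: cvgMl_tmp; exact: cvg_id].
have half : (2%:E * (\int[mu]_v (maxint (gaussian b) q `|t + a * v| * gaussian b v)%:E) =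
    2%:E * (c * maxint (gaussian b) rho `|t|)%:E)%E; last first.
  have two (x : \bar R) : (2^-1%:E * (2%:E * x) = x)%E.
    by rewrite muleA -EFinM mulVf// mul1e.
  by rewrite -[LHS]two half two.
(* A planar rotation, carried out by affine substitutions in one variable: w is exchanged for y = (a
   v + q w) / rho, so that t + a v + q w = t + rho y and v^2 + w^2 = y^2 + ((rho v - a y) / q)^2.
   Once the order is swapped, the integral in v does not depend on y up to the factor in front. *)
transitivity (\int[mu]_v \int[mu]_y
   (`|t + rho * y| * gaussian b y * (rho / q * gaussian b (rho / q * v - a / q * y)))%:E)%E.
  transitivity (\int[mu]_v (\int[mu]_w (`|t + a * v + q * w| * gaussian b w)%:E
      * (gaussian b v)%:E))%E.
    rewrite -ge0_integralZl//=.
    - apply: eq_integral => v _; rewrite integralT_abs_gaussian// (gtr0_norm q0).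
      by rewrite -!EFinM mulrA.
    - apply/measurable_EFinP; apply: continuous_measurable_fun => v.
      apply: cvgM; last exact: cg.
      by apply: continuous_maxint_affine; [exact: weight_gaussian|exact: ltW].
    - move=> v _; rewrite lee_fin mulr_ge0//; apply: Rintegral_ge0 => w _.
      by rewrite mulr_ge0// le_max normr_ge0.
  apply: eq_integral => v _; rewrite -ge0_integralZr//=; first last.
  - by rewrite lee_fin.
  - by move=> w _; rewrite lee_fin mulr_ge0.
  - apply/measurable_EFinP; apply: continuous_measurable_fun => w.
    by apply: cvgM; [apply: cvg_norm; exact: clin|exact: cg].
  under eq_integral do rewrite -EFinM.
  rewrite (integralT_affine (rho / q) (- (a / q * v)))//; first last.
  - by move=> w; rewrite !mulr_ge0.
  - move=> w; apply: cvgMr_tmp; apply: cvgM; last exact: cg.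
    by apply: cvg_norm; exact: clin.
  apply: eq_integral => y _; congr EFin.
  have -> : t + a * v + q * (rho / q * y - a / q * v) = t + rho * y.
    by field; rewrite gt_eqF.
  have gg : gaussian b (rho / q * y - a / q * v) * gaussian b v =
      gaussian b y * gaussian b (rho / q * v - a / q * y); last first.
    move: gg; move: (gaussian b (_ - _)) (gaussian b v) (gaussian b y) => g1 g2 g3 gg.
    transitivity (`|t + rho * y| * (g1 * g2) * (rho / q)); first by ring.
    by rewrite gg; ring.
  rewrite /gaussian -!expRD; congr expR.
  rewrite -!opprD -!mulrDr; congr (- (b * _)).
  have -> : rho / q * y - a / q * v = (rho * y - a * v) / q by field; rewrite gt_eqF.
  have -> : rho / q * v - a / q * y = (rho * v - a * y) / q by field; rewrite gt_eqF.
  rewrite !exprMn; apply: (@mulIf _ (q ^+ 2)); first by rewrite expf_neq0// gt_eqF.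
  rewrite !mulrDl !exprVn !divfK ?expf_neq0 ?gt_eqF//.
  rewrite (_ : (rho * y - a * v) ^+ 2 = rho ^+ 2 * y ^+ 2 - rho * y * a * v *+ 2 + a ^+ 2 * v ^+ 2);
    last by rewrite mulr2n; ring.
  rewrite (_ : (rho * v - a * y) ^+ 2 = rho ^+ 2 * v ^+ 2 - rho * y * a * v *+ 2 + a ^+ 2 * y ^+ 2);
    last by rewrite mulr2n; ring.
  by rewrite rhoE; ring.
pose f (x : R * R) : \bar R := (`|t + rho * x.2| * gaussian b x.2 *
  (rho / q * gaussian b (rho / q * x.1 - a / q * x.2)))%:E.
have mf : measurable_fun [set: R * R] f.
  have mg := @continuous_measurable_fun R _ cg.
  have mlin (x y : R) : measurable_fun [set: R] (fun v => x + y * v).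
    by apply: continuous_measurable_fun; exact: clin.
  apply/measurable_EFinP; apply: measurable_funM.
    apply: measurable_funM; last exact: measurableT_comp mg _.
    apply: measurableT_comp; first exact: normr_measurable.
    exact: (measurableT_comp (mlin t rho) measurable_snd).
  apply: measurable_funM => //; apply: (measurableT_comp mg).
  by apply: measurable_funB; apply: measurable_funM.
have f0 x : (0 <= f x)%E.
  by rewrite lee_fin; apply: mulr_ge0; apply: mulr_ge0 => //; exact: ltW.
transitivity (\int[mu]_y \int[mu]_v f (v, y))%E.
  exact: (@fubini_tonelli _ _ _ _ _ mu mu f mf f0).
have inner y : (\int[mu]_v f (v, y) = (c * (`|t + rho * y| * gaussian b y))%:E)%E.
  rewrite [in RHS]mulrC EFinM -cE (integralT_affine (rho / q) (- (a / q * y)))//.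
  rewrite -ge0_integralZl//=.
  - by apply: eq_integral => v _; rewrite -EFinM /f/=; congr EFin; ring.
  - apply/measurable_EFinP; apply: continuous_measurable_fun => v.
    apply: cvgMr_tmp.
    apply: (@continuous_comp _ _ _ (fun v : R => rho / q * v - a / q * y)); last exact: cg.
    by apply: cvgD; [apply: cvgMl_tmp; exact: cvg_id|exact: cvg_cst].
  - by move=> v _; rewrite lee_fin mulr_ge0// ltW.
  - by rewrite lee_fin mulr_ge0.
under eq_integral do rewrite inner EFinM.
rewrite ge0_integralZl//=.
- by rewrite integralT_abs_gaussian// (gtr0_norm rho0) -!EFinM mulrCA.
- apply/measurable_EFinP; apply: continuous_measurable_fun => v.
  by apply: cvgM; [apply: cvg_norm; exact: clin|exact: cg].
- by move=> v _; rewrite lee_fin mulr_ge0.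
- by rewrite lee_fin ltW.
Qed.

End gaussian_integrals.

(** * Zonal functions *)

Section zonal_theory.
Context {R : realType} {n : nat}.
Implicit Types (u : 'rV[R]_n) (h : 'rV[R]_n -> R).
Local Notation mu := (@lebesgue_measure R).
Local Notation halfline := [set` `[(0 : R), +oo[].
Local Notation enorm := (@euclidean_norm R n).

Lemma zonal_approx h : (forall e, 0 < e ->
    exists2 h', zonal h' & forall u, `|h u - h' u| <= e * enorm u) -> zonal h.
Proof.
move=> H e e0; have e20 : 0 < e / 2 by rewrite divr_gt0.
have [h' zh' hh'] := H _ e20; have [s sP] := zh' _ e20; exists s => u.
have := sP u; have := hh' u; rewrite !ler_norml => /andP[? ?] /andP[? ?].
by apply/andP; split; lra.
Qed.

Lemma zonal_ext h h' : zonal h -> h =1 h' -> zonal h'.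
Proof. by move=> zh /funext <-. Qed.

Lemma zonal_abs (v : 'rV[R]_n) : zonal (fun u => `|dotv u v|).
Proof.
move=> e e0; exists [:: v] => u.
by rewrite big_seq1 subrr normr0 mulr_ge0 ?enorm_ge0// ltW.
Qed.

Lemma zonal0 : zonal (fun _ : 'rV[R]_n => 0 : R).
Proof.
move=> e e0; exists [::] => u.
by rewrite big_nil subrr normr0 mulr_ge0 ?enorm_ge0// ltW.
Qed.

Lemma zonalD h h' : zonal h -> zonal h' -> zonal (fun u => h u + h' u).
Proof.
move=> zh zh' e e0; have e20 : 0 < e / 2 by rewrite divr_gt0.
have [s sP] := zh _ e20; have [s' s'P] := zh' _ e20; exists (s ++ s') => u.
have := sP u; have := s'P u; rewrite !ler_norml big_cat/= => /andP[? ?] /andP[? ?].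
by apply/andP; split; lra.
Qed.

Lemma zonalZ a h : 0 <= a -> zonal h -> zonal (fun u => a * h u).
Proof.
move=> a0 zh e e0; have a10 : 0 < a + 1 by rewrite ltr_wpDl.
have [s sP] := zh (e / (a + 1)) (divr_gt0 e0 a10).
exists [seq a *: v | v <- s] => u; rewrite big_map.
under eq_bigr do rewrite dotvZr normrM (ger0_norm a0).
rewrite -mulr_sumr -mulrBr normrM (ger0_norm a0).
apply: (le_trans (ler_wpM2l a0 (sP u))).
rewrite mulrA ler_wpM2r ?enorm_ge0// mulrCA ler_piMr ?(ltW e0)//.
by rewrite ler_pdivrMr// mul1r lerDl.
Qed.

Lemma zonal_sum (I : eqType) (s : seq I) (h_ : I -> 'rV[R]_n -> R) :
  (forall i, i \in s -> zonal (h_ i)) -> zonal (fun u => \sum_(i <- s) h_ i u).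
Proof.
elim: s => [|i s IH] H.
  by apply: zonal_ext zonal0 _ => u; rewrite big_nil.
apply: (zonal_ext (fun u => h_ i u + \sum_(j <- s) h_ j u)); last first.
  by move=> u; rewrite big_cons.
apply: zonalD; first by apply: H; rewrite mem_head.
by apply: IH => j js; apply: H; rewrite in_cons js orbT.
Qed.

Import HBNNSimple.

(* Discretising the parameter through the library's simple approximations
   [g_ m] of the identity turns the integral into a finite sum. *)
Lemma zonal_integral (H : 'rV[R]_n -> R -> R) (k : R -> R) K : weight k ->
  (forall v, 0 <= v -> zonal (H ^~ v)) ->
  (forall u, measurable_fun halfline (H u)) ->
  (forall u v v', 0 <= v -> 0 <= v' -> `|H u v - H u v'| <= K * enorm u * `|v - v'|) ->
  (forall u, `|H u 0| <= K * enorm u) -> 0 <= K ->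
  zonal (fun u => \int[mu]_(v in halfline) (H u v * k v)).
Proof.
move=> wk zH mH lipH H0 K0; have [mk k0 ik] := wk.
have mD : measurable (halfline : set (measurableTypeR R)) by exact: measurable_itv.
have mE : measurable_fun (halfline : set (measurableTypeR R)) (fun v : R => v%:E).
  by apply/measurable_EFinP.
pose g_ m : R -> R := nnsfun_approx mD mE m.
have E0 v : halfline v -> (0 <= v%:E)%E by move=> /halflineP v0; rewrite lee_fin.
have g0 m v : 0 <= g_ m v by rewrite /g_; exact: fun_ge0.
have gle m v : 0 <= v -> g_ m v <= v.
  move=> /halflineP Dv; rewrite -lee_fin /g_ nnsfun_approxE.
  exact: (@le_approx _ _ _ _ (fun v : R => v%:E)).
have gcvg v : 0 <= v -> g_ m v @[m --> \oo] --> v.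
  move=> /halflineP Dv; have := cvg_nnsfun_approx mD mE E0 Dv.
  by move=> /fine_cvgP[].
have mg m : measurable_fun halfline (g_ m).
  have mg' : measurable_fun setT (nnsfun_approx mD mE m) by exact: measurable_funPT.
  by apply: measurable_funTS; exact: mg'.
pose d_ m v := `|v - g_ m v| * k v.
have md m : measurable_fun halfline (d_ m).
  apply: measurable_funM => //; apply: measurableT_comp => //.
  exact: measurable_funB.
have dle m v : 0 <= v -> `|d_ m v| <= 1 * ((1 + v) * k v).
  move=> v0; rewrite mul1r ger0_norm ?mulr_ge0 ?k0// ler_wpM2r ?k0//.
  rewrite ger0_norm ?subr_ge0 ?gle//; have := g0 m v; lra.
have id m : mu.-integrable halfline (EFin \o d_ m).
  exact: integrable_weight wk (md m) (dle m).
have dcvg : \int[mu]_(v in halfline) d_ m v @[m --> \oo] --> 0.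
  have : (\int[mu]_(v in halfline) (d_ m v)%:E)%E @[m --> \oo] -->
      (\int[mu]_(v in halfline) (0%:E))%E.
    apply: (@dominated_cvg _ _ _ mu halfline _ (fun m v => (d_ m v)%:E)
      _ (fun v => ((1 + v) * k v)%:E)) => //.
    - by move=> m; apply/measurable_EFinP; exact: md.
    - move=> v /halflineP v0; apply: cvg_EFin; first exact: nearW.
      rewrite -[X in _ --> X](mul0r (k v)); apply: cvgMr_tmp.
      rewrite -(normr0 R) -(subrr v); apply: cvg_norm; apply: cvgB; first exact: cvg_cst.
      exact: gcvg.
    - move=> m v /halflineP v0; rewrite lee_fin; have := dle m v v0.
      by rewrite mul1r.
  rewrite integral0 => /fine_cvgP[_]; exact.
have iHk u : mu.-integrable halfline (EFin \o (fun v => H u v * k v)).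
  apply: (integrable_weight k _ (K * enorm u) wk); first exact: measurable_funM.
  move=> v v0; rewrite normrM (ger0_norm (k0 _ v0)) mulrA ler_wpM2r ?k0//.
  have := lipH u v 0 v0 (lexx _); have := H0 u; rewrite subr0 (ger0_norm v0).
  have := ler_normD (H u v - H u 0) (H u 0); rewrite subrK mulrDr mulr1; lra.
apply: zonal_approx => e e0.
have K10 : 0 < K + 1 by rewrite ltr_wpDl.
(* By the Lipschitz bound, replacing v by [g_ m v] costs at most K |u| times this integral, for all
   u at once. [K + 1] avoids a division by 0. *)
have [m dm] : exists m, \int[mu]_(v in halfline) d_ m v <= e / (K + 1).
  have /cvgrPdist_le/(_ _ (divr_gt0 e0 K10))[m _ /(_ m (leqnn m))] := dcvg.
  rewrite /= sub0r normrN => dm; exists m; exact: le_trans (ler_norm _) dm.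
have /finite_seqP[s0 s0E] := @fimfunP _ _ (nnsfun_approx mD mE m).
rewrite -/(g_ m) in s0E.
pose s := undup s0.
have gs v : g_ m v \in s.
  by rewrite mem_undup; have : range (g_ m) (g_ m v) by []; rewrite s0E.
have s_ge0 c : c \in s -> 0 <= c.
  rewrite mem_undup => cs; have : range (g_ m) c by rewrite s0E.
  by move=> [v _ <-].
pose a_ c := \int[mu]_(v in halfline) (\1_(g_ m @^-1` [set c]) v * k v).
have mind c : measurable_fun halfline (\1_(g_ m @^-1` [set c]) : R -> R).
  apply: measurable_funTS; apply/measurable_indicP.
  exact: (measurable_funPTI (nnsfun_approx mD mE m)).
have iind c : mu.-integrable halfline (EFin \o (fun v => \1_(g_ m @^-1` [set c]) v * k v)).
  apply: (integrable_weight k _ 1 wk); first exact: measurable_funM.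
  move=> v v0; rewrite mul1r normrM (ger0_norm (k0 _ v0)) ler_wpM2r ?k0//.
  by rewrite indicE; case: (_ \in _); rewrite ?normr1 ?normr0; lra.
have disc u v : H u (g_ m v) * k v =
    \sum_(c <- s) (H u c * (\1_(g_ m @^-1` [set c]) v * k v)).
  rewrite (bigD1_seq (g_ m v)) ?undup_uniq//= indicE mem_set// mul1r.
  rewrite big1 ?addr0// => c cg; rewrite indicE memNset ?mul0r ?mulr0//.
  by move=> /= gc; rewrite gc eqxx in cg.
have idisc u : mu.-integrable halfline (EFin \o (fun v => H u (g_ m v) * k v)).
  rewrite (_ : EFin \o _ = (fun v => \sum_(c <- s)
      (H u c * (\1_(g_ m @^-1` [set c]) v * k v))%:E)%E); last first.
    by apply/funext => v; rewrite sumEFin -disc.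
  apply: (integrable_sum mD) => c _.
  exact: (integrableZl mD _ (iind c)).
have discE u : \int[mu]_(v in halfline) (H u (g_ m v) * k v) =
    \sum_(c <- s) (a_ c * H u c).
  rewrite /Rintegral.
  under eq_integral do rewrite disc -sumEFin.
  rewrite (integral_sum mD); last by move=> c; exact: (integrableZl mD _ (iind c)).
  rewrite (eq_bigr (fun c => (a_ c * H u c)%:E)) ?sumEFin// => c _.
  under eq_integral do rewrite EFinM.
  rewrite integralZl//; last exact: iind.
  rewrite mulrC EFinM /a_ /Rintegral fineK//.
  exact: (integrable_fin_num mD (iind c)).
exists (fun u => \sum_(c <- s) (a_ c * H u c)).
  apply: zonal_sum => c cs; apply: zonalZ.
    apply: Rintegral_ge0 => v /halflineP v0; rewrite mulr_ge0 ?k0//.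
  by apply: zH; exact: s_ge0.
move=> u; rewrite -discE -RintegralB//.
have iB : mu.-integrable halfline (EFin \o (fun v => H u v * k v - H u (g_ m v) * k v)).
  exact: (integrableB mD (iHk u) (idisc u)).
apply: (le_trans (le_normr_Rintegral mD iB)).
apply: (@le_trans _ _ (\int[mu]_(v in halfline) (K * enorm u * d_ m v))).
  apply: le_Rintegral => //.
  - exact: (integrable_norm iB).
  - exact: (integrableZl mD _ (id m)).
  - move=> v /halflineP v0; rewrite -mulrBl normrM (ger0_norm (k0 _ v0)) /d_ mulrA.
    by rewrite ler_wpM2r ?k0// lipH.
rewrite RintegralZl// mulrAC ler_wpM2r ?enorm_ge0//.
apply: (le_trans (ler_wpM2l K0 dm)).
by rewrite mulrCA ler_piMr ?(ltW e0)// ler_pdivrMr// mul1r lerDl.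
Qed.

End zonal_theory.

(** * Continuity of the integrals in the density *)

Section maxint_limits.
Context {R : realType}.
Local Notation mu := (@lebesgue_measure R).
Local Notation halfline := [set` `[(0 : R), +oo[].

Lemma maxint_dist (k k' : R -> R) r s : weight k -> weight k' -> 0 <= r -> 0 <= s ->
  `|maxint k r s - maxint k' r s| <=
  (r + s) * \int[mu]_(v in halfline) ((1 + v) * `|k v - k' v|).
Proof.
move=> wk wk' r0 s0; have [mk k0 ik] := wk; have [mk' k'0 ik'] := wk'.
have mD : measurable (halfline : set (measurableTypeR R)) by exact: measurable_itv.
have iB : mu.-integrable halfline
    (EFin \o (fun v => Num.max s (r * v) * k v - Num.max s (r * v) * k' v)).
  exact: (integrableB mD (integrable_maxint _ _ _ wk r0 s0)
    (integrable_maxint _ _ _ wk' r0 s0)).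
have iN : mu.-integrable halfline (EFin \o (fun v => (1 + v) * `|k v - k' v|)).
  have iB' : mu.-integrable halfline (EFin \o (fun v => (1 + v) * k v - (1 + v) * k' v)).
    exact: (integrableB mD ik ik').
  apply: (eq_integrable mD _ _ _ (integrable_norm iB')) => v /[!inE] /halflineP v0 /=.
  by rewrite -mulrBr normrM ger0_norm// addr_ge0.
rewrite /maxint -RintegralB//; last 2 first.
- exact: integrable_maxint.
- exact: integrable_maxint.
rewrite -RintegralZl//.
apply: (le_trans (le_normr_Rintegral mD iB)); apply: le_Rintegral => //.
- exact: (integrable_norm iB).
- exact: (integrableZl mD _ iN).
move=> v /halflineP v0; have /andP[m0 m1] := maxr_le_weight r s v r0 s0 v0.
by rewrite -mulrBr normrM (ger0_norm m0) mulrA ler_wpM2r.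
Qed.

Lemma weight_dominated (W k : R -> R) : weight W -> measurable_fun halfline k ->
  (forall v, 0 <= v -> 0 <= k v <= W v) -> weight k.
Proof.
move=> wW mk kW; have [_ W0 _] := wW.
split=> [//|v v0|]; first by have /andP[] := kW v v0.
apply: (integrable_weight W _ 1 wW).
  by apply: measurable_funM => //; exact: measurable_funD.
move=> v v0; have /andP[k0 k1] := kW v v0; rewrite mul1r ger0_norm ?mulr_ge0 ?addr_ge0//.
by rewrite ler_wpM2l// addr_ge0.
Qed.

Lemma weightZ (k : R -> R) a : 0 <= a -> weight k -> weight (fun v => a * k v).
Proof.
move=> a0 [mk k0 ik].
have mD : measurable (halfline : set (measurableTypeR R)) by exact: measurable_itv.
split=> [|v v0|]; [exact: measurable_funM|by rewrite mulr_ge0 ?k0|].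
apply: (eq_integrable mD _ _ _ (integrableZl mD a ik)) => v _.
by rewrite -EFinM; congr EFin; ring.
Qed.

Lemma maxint_dominated_cvg (k_ : nat -> R -> R) (k W : R -> R) :
  (forall j, weight (k_ j)) -> weight k -> weight W ->
  (forall j v, 0 <= v -> k_ j v <= W v) -> (forall v, 0 <= v -> k v <= W v) ->
  (forall v, 0 <= v -> k_ j v @[j --> \oo] --> k v) ->
  \int[mu]_(v in halfline) ((1 + v) * `|k_ j v - k v|) @[j --> \oo] --> 0.
Proof.
move=> wk_ wk wW k_W kW k_k; have [mk k0 ik] := wk; have [mW W0 iW] := wW.
have : (\int[mu]_(v in halfline) ((1 + v) * `|k_ j v - k v|)%:E)%E @[j --> \oo] -->
    (\int[mu]_(v in halfline) (0%:E))%E.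
  apply: (@dominated_cvg _ _ _ mu halfline _
    (fun j v => ((1 + v) * `|k_ j v - k v|)%:E)
    _ (fun v => ((1 + v) * W v)%:E)) => //.
  - move=> j; have [mkj _ _] := wk_ j.
    apply/measurable_EFinP; apply: measurable_funM; first exact: measurable_funD.
    by apply: measurableT_comp => //; exact: measurable_funB.
  - move=> v /halflineP v0; apply: cvg_EFin; first exact: nearW.
    rewrite -[X in _ --> X](mulr0 (1 + v)); apply: cvgMl_tmp.
    rewrite -(normr0 R) -(subrr (k v)); apply: cvg_norm; apply: cvgB; first exact: k_k.
    exact: cvg_cst.
  - move=> j v /halflineP v0; have [_ kj0 _] := wk_ j.
    rewrite lee_fin ger0_norm ?mulr_ge0 ?addr_ge0// ler_wpM2l ?addr_ge0//.
    have := k_W j v v0; have := kW v v0; have := k0 v v0; have := kj0 v v0.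
    by rewrite ler_norml => ? ? ? ?; apply/andP; split; lra.
by rewrite integral0 => /fine_cvgP[_]; exact.
Qed.

End maxint_limits.

(** * Zonality from completely monotone densities *)

Section zonal_maxint_theory.
Context {R : realType} {n : nat}.
Implicit Types (u : 'rV[R]_n) (s : seq 'rV[R]_n).
Local Notation mu := (@lebesgue_measure R).
Local Notation halfline := [set` `[(0 : R), +oo[].
Local Notation enorm := (@euclidean_norm R n).

(** The standard deviation of <u, X>, where X is the sum of the vectors of [s] with independent
    standard Gaussian coefficients. *)
Definition seminorm s u : R := Num.sqrt (\sum_(a <- s) dotv u a ^+ 2).

Lemma seminorm_ge0 s u : 0 <= seminorm s u.
Proof. exact: sqrtr_ge0. Qed.

Lemma seminorm_cons a s u :
  seminorm (a :: s) u = Num.sqrt (seminorm s u ^+ 2 + dotv u a ^+ 2).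
Proof.
rewrite /seminorm big_cons addrC sqr_sqrtr//.
by apply: sumr_ge0 => v _; exact: sqr_ge0.
Qed.

Lemma seminorm_le s : exists2 C, 0 <= C & forall u, seminorm s u <= C * enorm u.
Proof.
elim: s => [|a s [C C0 IH]].
  by exists 0 => // u; rewrite /seminorm big_nil sqrtr0 mul0r.
exists (C + enorm a) => [|u]; first by rewrite addr_ge0 ?enorm_ge0.
rewrite seminorm_cons; set q := seminorm s u.
have q0 : 0 <= q := seminorm_ge0 s u.
apply: (@le_trans _ _ (q + `|dotv u a|)).
  rewrite -[leRHS]ger0_norm ?addr_ge0// -sqrtr_sqr ler_wsqrtr// sqrrD.
  by rewrite real_normK ?num_real// addrAC lerDl mulrn_wge0// mulr_ge0.
rewrite mulrDl; apply: lerD; first exact: IH.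
by rewrite mulrC; exact: cauchy_schwarz.
Qed.

(** By [maxint_gaussian_conv], adding [a] to [s] amounts to averaging, over a Gaussian coefficient
    v, the functions with [w] displaced by v a. These are zonal because the induction hypothesis
    covers every [w]. *)
Lemma zonal_gaussian b s w : 0 < b ->
  zonal (fun u => maxint (gaussian b) (seminorm s u) `|dotv u w|).
Proof.
move=> b0; have wg := weight_gaussian _ b0.
have [mg g0 ig] := wg.
elim: s w => [|a s IH] w.
  apply: zonal_ext (zonalZ (maxint (gaussian b) 0 1) _ _ (zonal_abs w)) _.
    by apply: Rintegral_ge0 => v _; rewrite mulr_ge0 ?gaussian_ge0// le_max ler01.
  by move=> u; rewrite /seminorm big_nil sqrtr0 mulrC -maxintZ// mulr0 mulr1.
have [c c0 cE] := maxint_gaussian_conv _ b0.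
have [C C0 sC] := seminorm_le s.
pose I := \int[mu]_(v in halfline) ((1 + v) * gaussian b v).
have I0 : 0 <= I.
  by apply: Rintegral_ge0 => v /halflineP v0; rewrite mulr_ge0 ?gaussian_ge0// addr_ge0.
(* The displacements v a and - v a are paired so that the integral runs over the half-line, as
   [zonal_integral] requires. *)
pose H u v := maxint (gaussian b) (seminorm s u) `|dotv u (w + v *: a)| +
  maxint (gaussian b) (seminorm s u) `|dotv u (w - v *: a)|.
have HE u : \int[mu]_(v in halfline) (H u v * gaussian b v) =
    c * maxint (gaussian b) (seminorm (a :: s) u) `|dotv u w|.
  rewrite seminorm_cons /Rintegral.
  have := cE (seminorm s u) (dotv u a) (dotv u w) (seminorm_ge0 _ _).
  rewrite integralT_fold => [E||v]; first last.
  - rewrite mulr_ge0 ?gaussian_ge0//; apply: Rintegral_ge0 => w' _.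
    by rewrite mulr_ge0 ?gaussian_ge0// le_max normr_ge0.
  - move=> v; apply: cvgM; last exact: continuous_gaussian.
    by apply: continuous_maxint_affine => //; exact: seminorm_ge0.
  rewrite -[RHS]/(fine (_%:E)) -E; congr fine; apply: eq_integral => v _; congr EFin.
  rewrite /H !dotvDr !dotvNr !dotvZr mulrDl mulrN !(mulrC v).
  by congr (_ + _ * _); rewrite /gaussian sqrrN.
suff zH : zonal (fun u => \int[mu]_(v in halfline) (H u v * gaussian b v)).
  apply: zonal_ext (zonalZ c^-1 _ _ zH) _; first by rewrite invr_ge0 ltW.
  by move=> u; rewrite HE mulrA mulVf ?mul1r// gt_eqF.
have mlip (u : 'rV[R]_n) (x y : 'rV[R]_n) :
    `|maxint (gaussian b) (seminorm s u) `|dotv u x| -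
      maxint (gaussian b) (seminorm s u) `|dotv u y| | <= I * `|dotv u (x - y)|.
  apply: le_trans (maxint_lipschitz _ _ _ _ _ wg (seminorm_ge0 _ _) _ (seminorm_ge0 _ _) _) _ => //.
  rewrite subrr normr0 add0r -/I mulrC ler_wpM2l//.
  by rewrite dotvDr dotvNr; exact: ler_dist_dist.
apply: (zonal_integral H _ (2 * I * (C + enorm w + enorm a)) wg).
- by move=> v v0; apply: zonalD; exact: IH.
- move=> u; apply: measurable_funTS; apply: continuous_measurable_fun => v.
  have cm x := continuous_maxint_affine (gaussian b) (seminorm s u) (dotv u w) x wg
    (seminorm_ge0 s u) v.
  have -> : H u = (fun v => maxint (gaussian b) (seminorm s u) `|dotv u w + dotv u a * v| +
     maxint (gaussian b) (seminorm s u) `|dotv u w + - dotv u a * v|).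
    by apply/funext => v'; rewrite /H !dotvDr dotvNr dotvZr mulNr (mulrC v').
  by apply: cvgD; exact: cm.
- move=> u v v' v0 v'0.
  have L1 := mlip u (w + v *: a) (w + v' *: a).
  have L2 := mlip u (w - v *: a) (w - v' *: a).
  have E1 : w + v *: a - (w + v' *: a) = (v - v') *: a.
    by rewrite opprD addrACA subrr add0r scalerBl.
  have E2 : w - v *: a - (w - v' *: a) = - ((v - v') *: a).
    by rewrite opprD opprK addrACA subrr add0r scalerBl opprB addrC.
  rewrite E1 dotvZr normrM in L1; rewrite E2 dotvNr normrN dotvZr normrM in L2.
  have cs := cauchy_schwarz u a.
  have := ler_normD (maxint (gaussian b) (seminorm s u) `|dotv u (w + v *: a)| -
    maxint (gaussian b) (seminorm s u) `|dotv u (w + v' *: a)|)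
   (maxint (gaussian b) (seminorm s u) `|dotv u (w - v *: a)| -
    maxint (gaussian b) (seminorm s u) `|dotv u (w - v' *: a)|).
  rewrite addrACA -opprD -/(H u v) -/(H u v') => LH.
  apply: (@le_trans _ _ (2 * I * (`|v - v'| * (enorm u * enorm a)))).
    have := ler_wpM2l I0 (ler_wpM2l (normr_ge0 (v - v')) cs); lra.
  have -> : 2 * I * (C + enorm w + enorm a) * enorm u * `|v - v'| =
      2 * I * ((C + enorm w + enorm a) * enorm u * `|v - v'|) by ring.
  rewrite ler_wpM2l ?mulr_ge0//.
  have := mulr_ge0 (normr_ge0 (v - v')) (enorm_ge0 u).
  have := enorm_ge0 w; have := enorm_ge0 a; have := enorm_ge0 u.
  by move: (enorm w) (enorm a) (enorm u) `|v - v'| => x y z t; nra.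
- move=> u; rewrite /H scale0r oppr0 addr0.
  have le0 : maxint (gaussian b) (seminorm s u) `|dotv u w| <=
      (seminorm s u + `|dotv u w|) * I.
    rewrite /I -RintegralZl//; apply: le_Rintegral => //.
    + exact: integrable_maxint (seminorm_ge0 _ _) _.
    + have mD : measurable (halfline : set (measurableTypeR R)) by exact: measurable_itv.
      exact: (integrableZl mD _ ig).
    + move=> v /halflineP v0; rewrite mulrA ler_wpM2r ?gaussian_ge0//.
      by have /andP[] := maxr_le_weight _ _ v (seminorm_ge0 s u) (normr_ge0 (dotv u w)) v0.
  rewrite ger0_norm; last first.
    by rewrite addr_ge0//; apply: Rintegral_ge0 => v _;
      rewrite mulr_ge0 ?gaussian_ge0// le_max normr_ge0.
  apply: (@le_trans _ _ (2 * I * (C * enorm u + enorm u * enorm w))).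
    have h1 := sC u; have h2 := cauchy_schwarz u w.
    have := ler_wpM2r I0 (lerD h1 h2); lra.
  rewrite -[leRHS]mulrA ler_wpM2l ?mulr_ge0//.
  have := mulr_ge0 (enorm_ge0 u) (enorm_ge0 a); lra.
- by rewrite !mulr_ge0// !addr_ge0// enorm_ge0.
Qed.

Section limits.
Variables (s : seq 'rV[R]_n) (w : 'rV[R]_n).
Local Notation M k := (fun u => maxint k (seminorm s u) `|dotv u w|).

Lemma zonal_maxint_lim (k_ : nat -> R -> R) (k W : R -> R) :
  (forall j, weight (k_ j)) -> weight k -> weight W ->
  (forall j v, 0 <= v -> k_ j v <= W v) -> (forall v, 0 <= v -> k v <= W v) ->
  (forall v, 0 <= v -> k_ j v @[j --> \oo] --> k v) ->
  (forall j, zonal (M (k_ j))) -> zonal (M k).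
Proof.
move=> wk_ wk wW k_W kW k_k zk; apply: zonal_approx => e e0.
have [C C0 sC] := seminorm_le s.
have K0 : 0 < C + enorm w + 1 by rewrite ltr_wpDl// addr_ge0// enorm_ge0.
have := maxint_dominated_cvg _ _ _ wk_ wk wW k_W kW k_k.
move=> /cvgrPdist_le/(_ _ (divr_gt0 e0 K0))[j _ /(_ j (leqnn j))].
rewrite /= sub0r normrN => dj; exists (M (k_ j)) => // u.
rewrite distrC; apply: (le_trans (maxint_dist _ _ _ _ (wk_ j) wk (seminorm_ge0 _ _) _)) => //.
have uK : seminorm s u + `|dotv u w| <= (C + enorm w + 1) * enorm u.
  have := sC u; have := cauchy_schwarz u w; have := enorm_ge0 u; lra.
set J := Rintegral _ _ _ in dj *.
have J0 : 0 <= J.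
  by apply: Rintegral_ge0 => v /halflineP v0; rewrite mulr_ge0// addr_ge0.
rewrite ger0_norm// in dj.
apply: (@le_trans _ _ ((C + enorm w + 1) * enorm u * (e / (C + enorm w + 1)))).
  by apply: ler_pM => //; rewrite addr_ge0// seminorm_ge0.
by rewrite mulrAC mulrCA divff ?gt_eqF// mulr1.
Qed.

Lemma measurable_cm_sqr (g : R -> R) : completely_monotone g ->
  measurable_fun halfline (fun v => g (v ^+ 2)).
Proof.
elim=> [a b a0 b0|{}g h _ IHg _ IHh|g_ {}g _ IH gg].
- apply: measurable_funTS; apply: continuous_measurable_fun => v.
  by apply: cvgMl_tmp; exact: continuous_gaussian.
- exact: measurable_funD.
- have gg' v : halfline v -> g_ j (v ^+ 2) @[j --> \oo] --> g (v ^+ 2).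
    by move=> _; apply: gg; exact: sqr_ge0.
  exact: (measurable_fun_cvg IH gg').
Qed.

Lemma weight_cm_gaussian (g : R -> R) b : completely_monotone g -> 0 < b ->
  weight (fun v => g (v ^+ 2) * gaussian b v).
Proof.
move=> cg b0; have wg := weight_gaussian _ b0; have [mg _ _] := wg.
apply: (weight_dominated (fun v => g 0 * gaussian b v)).
- by apply: weightZ => //; exact: cm_ge0.
- by apply: measurable_funM => //; exact: measurable_cm_sqr.
- move=> v _; rewrite mulr_ge0 ?gaussian_ge0 ?(cm_ge0 _ cg) ?sqr_ge0//=.
  by rewrite ler_wpM2r ?gaussian_ge0// cm_le0// sqr_ge0.
Qed.

(** The induction on [g] may pass through functions, such as constants, whose composite with v^2 is
    not integrable. The Gaussian factor makes each of them a weight, and merges with the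
    exponentials in the base case. *)
Lemma zonal_cm_gaussian (g : R -> R) b : completely_monotone g -> 0 < b ->
  zonal (M (fun v => g (v ^+ 2) * gaussian b v)).
Proof.
move=> cg b0; elim: cg => [a b' a0 b'0|g1 g2 c1 IH1 c2 IH2|g_ {}g cg_ IH gg].
- have bb : 0 < b' + b by rewrite ltr_wpDl.
  apply: zonal_ext (zonalZ a _ a0 (zonal_gaussian _ s w bb)) _ => u.
  rewrite /maxint -RintegralZl//; last first.
    by apply: integrable_maxint; [exact: weight_gaussian|exact: seminorm_ge0|].
  apply: eq_Rintegral => v _; rewrite mulrCA; congr (_ * _).
  by rewrite -mulrA /gaussian -expRD; congr (_ * expR _); ring.
- apply: zonal_ext (zonalD _ _ IH1 IH2) _ => u.
  have i1 := integrable_maxint _ _ _ (weight_cm_gaussian _ _ c1 b0) (seminorm_ge0 s u)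
    (normr_ge0 (dotv u w)).
  have i2 := integrable_maxint _ _ _ (weight_cm_gaussian _ _ c2 b0) (seminorm_ge0 s u)
    (normr_ge0 (dotv u w)).
  rewrite /maxint -RintegralD//; apply: eq_Rintegral => v _.
  by rewrite -mulrDr -mulrDl.
- have cg := cm_lim _ _ cg_ gg.
  (* A convergent sequence of values at 0 is bounded; by [cm_le0] its bound yields one dominating
     function for all j. *)
  have [B gB] : exists B, forall j, g_ j 0 <= B.
    have [B [_ Bb]] := cvg_seq_bounded (cvgP _ (gg 0 (lexx _))).
    exists (B + 1) => j; apply: (le_trans (ler_norm _)).
    by apply: Bb => //; rewrite ltrDl.
  have B0 : 0 <= B by apply: le_trans (gB 0%N); exact: cm_ge0.
  apply: (zonal_maxint_lim (fun j v => g_ j (v ^+ 2) * gaussian b v) _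
    (fun v => (B + g 0) * gaussian b v)) => //.
  + by move=> j; exact: weight_cm_gaussian.
  + exact: weight_cm_gaussian.
  + by apply: weightZ (weight_gaussian _ b0); rewrite addr_ge0// cm_ge0.
  + move=> j v v0; rewrite ler_wpM2r ?gaussian_ge0//.
    apply: (le_trans (cm_le0 _ (cg_ j) _ (sqr_ge0 v))); apply: (le_trans (gB j)).
    by rewrite lerDl cm_ge0.
  + move=> v v0; rewrite ler_wpM2r ?gaussian_ge0//.
    by apply: (le_trans (cm_le0 _ cg _ (sqr_ge0 v))); rewrite lerDr.
  + by move=> v v0; apply: cvgMr_tmp; apply: gg; exact: sqr_ge0.
Qed.

(** The auxiliary Gaussian is removed by letting its parameter tend to 0, with the weight itself as
    dominating function. *)
Lemma zonal_cm (g : R -> R) : completely_monotone g -> weight (fun v => g (v ^+ 2)) ->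
  zonal (M (fun v => g (v ^+ 2))).
Proof.
move=> cg wg.
have e0 j : 0 < j.+1%:R^-1 :> R by rewrite invr_gt0.
apply: (zonal_maxint_lim (fun j v => g (v ^+ 2) * gaussian j.+1%:R^-1 v) _
  (fun v => g (v ^+ 2))) => //.
- by move=> j; exact: weight_cm_gaussian.
- move=> j v v0; rewrite ler_piMr ?(cm_ge0 _ cg _ (sqr_ge0 v))//.
  by rewrite /gaussian expR_le1 oppr_le0 mulr_ge0 ?sqr_ge0// ltW.
- move=> v v0; rewrite -[X in _ --> X]mulr1; apply: cvgMl_tmp.
  rewrite -[X in _ --> X]expR0; apply: continuous_cvg; first exact: continuous_expR.
  rewrite -[X in _ --> X]oppr0 -[X in _ --> - X](mul0r (v ^+ 2)).
  by apply: cvgN; apply: cvgMr_tmp; exact: cvg_harmonic.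
- by move=> j; apply: zonal_cm_gaussian.
Qed.

End limits.
End zonal_maxint_theory.

(** * Integral representation of the planar norms *)

Section maxint_primitive_theory.
Context {R : realType}.
Local Notation mu := (@lebesgue_measure R).
Local Notation halfline := [set` `[(0 : R), +oo[].

(** The hypotheses make [al x] the integral of k over [0, x] and [be x] that of v k v over [x, +oo[:
    the slope and the intercept of the tangent to [maxint k 1] at x. *)
Variables (k al be : R -> R).
Hypotheses (k0 : forall v, 0 <= v -> 0 <= k v) (ck : continuous k)
  (dal : forall v : R, is_derive v (1 : R) al (k v))
  (dbe : forall v : R, is_derive v (1 : R) be (- (v * k v)))
  (al0 : al 0 = 0) (aly : al v @[v --> +oo] --> (1 : R))
  (bey : be v @[v --> +oo] --> (0 : R)).

Let derivable_continuous (F f : R -> R) : (forall v : R, is_derive v (1 : R) F (f v)) ->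
  continuous F.
Proof.
move=> dF v; apply: differentiable_continuous; apply/derivable1_diffP.
by have [] := dF v.
Qed.

Let integraly (F f : R -> R) (l x : R) : 0 <= x -> (forall v, 0 <= v -> 0 <= f v) ->
  continuous f -> (forall v : R, is_derive v (1 : R) F (f v)) ->
  F v @[v --> +oo] --> l ->
  (\int[mu]_(v in [set` `[x, +oo[]) (f v)%:E = (l - F x)%:E)%E.
Proof.
move=> x0 f0 cf dF Fl; rewrite EFinB.
apply: (@ge0_continuous_FTC2y _ f F x l) => //.
- by move=> v xv; apply: f0; exact: le_trans xv.
- exact: continuous_subspaceT.
- by apply: cvg_at_right_filter; exact: (derivable_continuous _ _ dF).
- by move=> v _; rewrite derive1E; apply: derive_val.
Qed.

Let cvk : continuous (fun v : R => v * k v).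
Proof. by move=> v; apply: cvgM; [exact: cvg_id|exact: ck]. Qed.

Let dbeN (v : R) : is_derive v (1 : R) (fun v => - be v) (v * k v).
Proof. by rewrite -[_ * k v]opprK; exact: is_deriveN (dbe v). Qed.

Let integraly_vk x : 0 <= x ->
  (\int[mu]_(v in [set` `[x, +oo[]) (v * k v)%:E = (be x)%:E)%E.
Proof.
move=> x0.
have E := integraly (fun v => - be v) (fun v => v * k v) 0 x x0 _ cvk dbeN.
rewrite E ?sub0r ?opprK//.
- by move=> v v0; rewrite mulr_ge0// k0.
- by rewrite -oppr0; apply: cvgN.
Qed.

Lemma weight_primitive : weight k.
Proof.
have mk : measurable_fun [set: R] k by exact: continuous_measurable_fun.
split; [exact: measurable_funTS|exact: k0|].
apply/integrableP; split.
  apply/measurable_EFinP; apply: measurable_funTS; apply: measurable_funM => //.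
  exact: measurable_funD.
under eq_integral => v /[!inE] /halflineP v0.
  rewrite abse_EFin ger0_norm ?mulr_ge0 ?addr_ge0 ?k0// mulrDl mul1r.
  over.
have dF (v : R) : is_derive v (1 : R) (fun v => al v - be v) (k v + v * k v).
  by have := is_deriveB (dal v) (dbe v); rewrite opprK.
have cF : continuous (fun v : R => k v + v * k v).
  by move=> v; apply: cvgD; [exact: ck|exact: cvk].
rewrite (integraly _ _ 1 0 (lexx _) _ cF dF) ?ltry//.
- by move=> v v0; rewrite addr_ge0 ?mulr_ge0 ?k0.
- by rewrite -[X in _ --> X]subr0; apply: cvgB.
Qed.

Let wk := weight_primitive.

Lemma maxint01_primitive : maxint k 0 1 = 1.
Proof.
apply: EFin_inj; rewrite EFin_maxint//.
under eq_integral do rewrite mul0r max_l// mul1r.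
by rewrite (integraly al k 1 0 (lexx _) k0 ck dal aly) al0 subr0.
Qed.

(* Replacing the maximum by the choice of [s] before [x] and of [r v] after [x]
   gives the tangent to [maxint k] with gradient [(be x, al x)]. *)
Let split_integral x r s : 0 <= x -> 0 <= r -> 0 <= s ->
  (\int[mu]_(v in halfline) ((if v < x then s else r * v) * k v)%:E =
   (r * be x + s * al x)%:E)%E.
Proof.
move=> x0 r0 s0.
have mk : measurable_fun [set: R] k by exact: continuous_measurable_fun.
have mvk : measurable_fun [set: R] (fun v => v * k v) by exact: continuous_measurable_fun.
have eqh : halfline = [set` `[0, x[] `|` [set` `[x, +oo[].
  by rewrite -itv_bndbnd_setU// bnd_simp.
have disj : [disjoint [set` `[0, x[] & [set` `[x, +oo[]].
  rewrite disj_set2E; apply/eqP; rewrite -subset0 => v []/=.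
  by rewrite !in_itv/= andbT => /andP[_]; rewrite ltNge => /negP.
have mf : measurable_fun [set: R] (fun v => (if v < x then s else r * v) * k v).
  apply: measurable_funM => //; apply: measurable_fun_ifT => //.
  exact: measurable_fun_ltr.
rewrite eqh ge0_integral_setU//=; first last.
- move=> v vD; have v0 : 0 <= v.
    by case: vD; rewrite in_itv/=; [case/andP|rewrite andbT; exact: le_trans].
  rewrite lee_fin mulr_ge0 ?k0//.
  by case: ifP => // _; rewrite mulr_ge0.
- by apply/measurable_EFinP; exact: measurable_funTS.
rewrite addrC EFinD; congr (_ + _)%E.
- transitivity (\int[mu]_(v in [set` `[x, +oo[]) (r%:E * (v * k v)%:E))%E.
    apply: eq_integral => v /[!inE]/=; rewrite in_itv/= andbT leNgt => /negbTE ->.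
    by rewrite -EFinM mulrA.
  rewrite ge0_integralZl//=.
  + by rewrite integraly_vk.
  + by apply/measurable_EFinP; exact: measurable_funTS.
  + move=> v; rewrite in_itv/= andbT => xv.
    by have v0 := le_trans x0 xv; rewrite lee_fin mulr_ge0// k0.
- transitivity (\int[mu]_(v in [set` `[0%R, x[]) (s%:E * (k v)%:E))%E.
    apply: eq_integral => v /[!inE]/=; rewrite in_itv/= => /andP[_ ->].
    by rewrite -EFinM.
  rewrite ge0_integralZl//=; first last.
  + by move=> v; rewrite in_itv/= => /andP[v0 _]; rewrite lee_fin k0.
  + by apply/measurable_EFinP; exact: measurable_funTS.
  rewrite EFinM; congr (_ * _)%E.
  rewrite integral_itv_bndo_bndc; last by apply/measurable_EFinP; exact: measurable_funTS.
  move: x0; rewrite le_eqVlt => /predU1P[<-|x0].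
    by rewrite set_itv1 integral_set1 al0.
  rewrite (@continuous_FTC2 _ k al 0 x)//.
  + by rewrite al0 sube0.
  + exact: continuous_subspaceT.
  + have cal := derivable_continuous _ _ dal.
    split=> [v _||]; first by have [] := dal v.
    * by apply: cvg_at_right_filter; exact: cal.
    * by apply: cvg_at_left_filter; exact: cal.
  + by move=> v _; rewrite derive1E; apply: derive_val.
Qed.

(** For s = r x the maximum changes branch exactly at v = x, so the tangent at x is exact there. *)
Lemma maxint_primitive r x : 0 <= r -> 0 <= x ->
  maxint k r (r * x) = r * be x + r * x * al x.
Proof.
move=> r0 x0; apply: EFin_inj; rewrite EFin_maxint// ?mulr_ge0//.
rewrite -split_integral ?mulr_ge0//; apply: eq_integral => v _.
congr ((_ * _)%:E); case: ltP => vx.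
  by rewrite max_l// ler_wpM2l// ltW.
by rewrite max_r// ler_wpM2l.
Qed.

Lemma maxint_ge_tangent r s x : 0 <= r -> 0 <= s -> 0 <= x ->
  r * be x + s * al x <= maxint k r s.
Proof.
move=> r0 s0 x0; rewrite -lee_fin EFin_maxint// -split_integral//.
have mk : measurable_fun [set: R] k by exact: continuous_measurable_fun.
apply: ge0_le_integral => //.
- move=> v /halflineP v0; rewrite lee_fin mulr_ge0 ?k0//.
  by case: ifP => // _; rewrite mulr_ge0.
- apply/measurable_EFinP; apply: measurable_funTS; apply: measurable_funM => //.
  apply: measurable_fun_ifT => //; exact: measurable_fun_ltr.
- by apply/measurable_EFinP; apply: measurable_maxr_weight; exact: measurable_funTS.
- move=> v /halflineP v0; rewrite lee_fin ler_wpM2r ?k0//.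
  by case: ifP => _; rewrite le_max lexx ?orbT.
Qed.

(** The tangent at x = +oo, with gradient (0, 1); it serves the dual vectors lying on the axis. *)
Lemma maxint_ge_tangenty r s : 0 <= r -> 0 <= s -> s <= maxint k r s.
Proof.
move=> r0 s0.
have := maxintZ k 0 1 s wk (lexx _) ler01 s0; rewrite mulr0 mulr1 maxint01_primitive mulr1.
move=> sE; rewrite -[leLHS]sE; apply: le_Rintegral => //.
- exact: integrable_maxint.
- exact: integrable_maxint.
- move=> v /halflineP v0; rewrite ler_wpM2r ?k0// mul0r max_l//.
  by rewrite le_max lexx.
Qed.

End maxint_primitive_theory.

(** * Differentiation rules for explicit functions *)

Section real_derivatives.
Context {R : realType}.
Implicit Types (f g : R -> R) (x a b : R).

Lemma is_derive1_eq f x a b : is_derive x (1 : R) f a -> a = b -> is_derive x (1 : R) f b.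
Proof. by move=> + <-. Qed.

Lemma is_derive1_cst x a : is_derive x (1 : R) (fun=> a) 0.
Proof. exact: is_derive_cst. Qed.

Lemma is_derive1_id x : is_derive x (1 : R) (fun x => x) 1.
Proof. exact: is_derive_id. Qed.

Lemma is_derive1D f g x a b : is_derive x (1 : R) f a -> is_derive x (1 : R) g b ->
  is_derive x (1 : R) (fun x => f x + g x) (a + b).
Proof. exact: is_deriveD. Qed.

Lemma is_derive1M f g x a b : is_derive x (1 : R) f a -> is_derive x (1 : R) g b ->
  is_derive x (1 : R) (fun x => f x * g x) (f x * b + g x * a).
Proof. exact: is_deriveM. Qed.

Lemma is_derive1X f n x a : is_derive x (1 : R) f a ->
  is_derive x (1 : R) (fun x => f x ^+ n.+1) (n.+1%:R * f x ^+ n * a).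
Proof.
move=> df; elim: n => [|n IH].
  by apply: (is_derive1_eq _ _ a) => //; rewrite expr0 !mul1r.
under eq_fun do rewrite exprS.
apply: (is_derive1_eq _ _ _ _ (is_derive1M _ _ _ _ _ df IH)).
by rewrite -[in RHS]natr1 !exprS; ring.
Qed.

Lemma is_derive1V f x a : f x != 0 -> is_derive x (1 : R) f a ->
  is_derive x (1 : R) (fun x => (f x)^-1) (- (a / f x ^+ 2)).
Proof.
move=> fx df; apply: (is_derive1_eq _ _ _ _ (is_deriveV fx df)).
by rewrite /GRing.scale/= mulNr mulrC.
Qed.

Lemma is_derive1_chain f g x a b : is_derive (g x) (1 : R) f a -> is_derive x (1 : R) g b ->
  is_derive x (1 : R) (fun x => f (g x)) (a * b).
Proof. exact: is_derive1_comp. Qed.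

End real_derivatives.

(** * The two densities and their primitives *)

Section planar_densities.
Context {R : realType}.
Implicit Types x v z : R.

Lemma is_derive_csqr (c x : R) : is_derive x (1 : R) (fun x => c + x ^+ 2) (2 * x).
Proof.
apply: is_derive1_eq _ _ _ _ (is_derive1D _ _ _ _ _ (is_derive1_cst x c)
  (is_derive1X _ 1 _ _ (is_derive1_id x))) _.
by rewrite expr1; ring.
Qed.

Definition hyp x : R := Num.sqrt (2 + x ^+ 2).

Lemma hyp_arg_gt0 x : 0 < 2 + x ^+ 2.
Proof. by rewrite ltr_pwDl// sqr_ge0. Qed.

Lemma sqr_hyp x : hyp x ^+ 2 = 2 + x ^+ 2.
Proof. by rewrite sqr_sqrtr// ltW// hyp_arg_gt0. Qed.

Lemma hyp_gt0 x : 0 < hyp x.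
Proof. by rewrite sqrtr_gt0 hyp_arg_gt0. Qed.

Lemma hyp_neq0 x : hyp x != 0.
Proof. by rewrite gt_eqF// hyp_gt0. Qed.

Lemma onepsqr_gt0 x : 0 < 1 + x ^+ 2.
Proof. by rewrite ltr_pwDl// sqr_ge0. Qed.

Lemma onepsqr_neq0 x : 1 + x ^+ 2 != 0.
Proof. by rewrite gt_eqF// onepsqr_gt0. Qed.

Lemma is_derive_hyp x : is_derive x (1 : R) hyp (x / hyp x).
Proof.
apply: is_derive1_eq hyp _ _ _ (is_derive1_chain Num.sqrt (fun x => 2 + x ^+ 2) x _ _
  (is_derive1_sqrt (hyp_arg_gt0 x)) (is_derive_csqr 2 x)) _.
by rewrite -/(hyp x); field; rewrite hyp_neq0.
Qed.

Lemma is_derive_hypV x : is_derive x (1 : R) (fun x => (hyp x)^-1) (- (x / hyp x ^+ 3)).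
Proof.
apply: is_derive1_eq _ _ _ _ (is_derive1V _ _ _ (hyp_neq0 x) (is_derive_hyp x)) _.
by field; rewrite hyp_neq0.
Qed.

Lemma is_derive_onepsqrV x :
  is_derive x (1 : R) (fun x => (1 + x ^+ 2)^-1) (- (2 * x / (1 + x ^+ 2) ^+ 2)).
Proof. exact: (is_derive1V (fun x => 1 + x ^+ 2) _ _ (onepsqr_neq0 x) (is_derive_csqr 1 x)). Qed.

Lemma continuous_hypV : continuous (fun x => (hyp x)^-1).
Proof.
move=> x; apply: differentiable_continuous; apply/derivable1_diffP.
by have [] := is_derive_hypV x.
Qed.

(* [density1], the second derivative of x |-> (1 + x^2) / hyp x, and its two
   primitives: the intercept and the slope of the tangent line at x. *)
Definition density1 x : R := 6 * (hyp x)^-1 ^+ 5.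
Definition slope1 x : R := x * (3 + x ^+ 2) * (hyp x)^-1 ^+ 3.
Definition intercept1 x : R := 2 * (hyp x)^-1 ^+ 3.

Lemma continuous_density1 : continuous density1.
Proof.
move=> x; apply: cvgMl_tmp.
apply: (@continuous_comp _ _ _ (fun x => (hyp x)^-1) (fun y : R => y ^+ 5)).
  exact: continuous_hypV.
exact: exprn_continuous.
Qed.

Lemma density1_ge0 x : 0 <= density1 x.
Proof. by rewrite mulr_ge0// exprn_ge0// invr_ge0 ltW// hyp_gt0. Qed.

Lemma is_derive_slope1 x : is_derive x (1 : R) slope1 (density1 x).
Proof.
apply: is_derive1_eq _ _ _ _ (is_derive1M _ _ _ _ _
  (is_derive1M _ _ _ _ _ (is_derive1_id x) (is_derive_csqr 3 x))
  (is_derive1X _ 2 _ _ (is_derive_hypV x))) _.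
rewrite /density1; have h0 := hyp_neq0 x; have h2 := sqr_hyp x.
apply: (@mulIf _ (hyp x ^+ 5)); first by rewrite expf_neq0.
transitivity (3 * (hyp x ^+ 2 * (1 + x ^+ 2) - x ^+ 2 * (3 + x ^+ 2))); first by field.
by rewrite h2; field.
Qed.

Lemma is_derive_intercept1 x : is_derive x (1 : R) intercept1 (- (x * density1 x)).
Proof.
apply: is_derive1_eq _ _ _ _ (is_derive1M _ _ _ _ _ (is_derive1_cst x 2)
  (is_derive1X _ 2 _ _ (is_derive_hypV x))) _.
by rewrite /density1; field; rewrite hyp_neq0.
Qed.

Lemma cvg_pinfty_bound (f : R -> R) (l C : R) :
  (forall x, 1 <= x -> `|l - f x| <= C / x) -> f x @[x --> +oo] --> l.
Proof.
move=> fC; apply/cvgrPdist_le => e e0; near=> x.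
have x1 : 1 <= x by near: x; apply: nbhs_pinfty_ge; rewrite num_real.
apply: (le_trans (fC _ x1)).
rewrite ler_pdivrMr ?(lt_le_trans _ x1)// mulrC -ler_pdivrMr//.
Unshelve. all: by end_near. Qed.

Lemma hyp_ge x : 0 <= x -> x <= hyp x.
Proof.
move=> x0; rewrite -(ler_pXn2r (n := 2)) ?nnegrE ?(ltW (hyp_gt0 _))// sqr_hyp.
by rewrite lerDr.
Qed.

(** The slopes contain a square root but their squares are rational in x^2, so the limit 1 is read
    off from the squares. *)
Let onem_sqr_le (a : R) : 0 <= a -> a <= 1 -> 1 - a <= 1 - a ^+ 2.
Proof. by move=> a0 a1; rewrite lerB// expr2 ler_piMl. Qed.

Lemma sqr_slope1 x : slope1 x ^+ 2 = 1 - (3 * hyp x ^+ 2 + 2) / hyp x ^+ 6.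
Proof.
have h0 := hyp_neq0 x; have h2 := sqr_hyp x.
have -> : slope1 x = x * (1 + hyp x ^+ 2) / hyp x ^+ 3.
  by rewrite h2 /slope1 exprVn; congr (_ * _ * _); ring.
have -> : (x * (1 + hyp x ^+ 2) / hyp x ^+ 3) ^+ 2 =
    (hyp x ^+ 2 - 2) * (1 + hyp x ^+ 2) ^+ 2 / hyp x ^+ 6.
  by rewrite h2 [2 + _ - _]addrC addKr; field; rewrite h0.
by field.
Qed.

Lemma slope1_ge0 x : 0 <= x -> 0 <= slope1 x.
Proof.
move=> x0; rewrite !mulr_ge0 ?exprn_ge0 ?invr_ge0 ?(ltW (hyp_gt0 _))//.
by rewrite addr_ge0// sqr_ge0.
Qed.

Lemma slope1_le1 x : 0 <= x -> slope1 x <= 1.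
Proof.
move=> x0; rewrite -(ler_pXn2r (n := 2)) ?nnegrE ?slope1_ge0// expr1n sqr_slope1.
rewrite gerBl divr_ge0// ?exprn_ge0 ?(ltW (hyp_gt0 _))//.
by rewrite addr_ge0// mulr_ge0// sqr_ge0.
Qed.

Lemma hyp_ge1 x : 1 <= hyp x.
Proof.
rewrite -(ler_pXn2r (n := 2)) ?nnegrE ?(ltW (hyp_gt0 _))// sqr_hyp expr1n.
by have := sqr_ge0 x; lra.
Qed.

Lemma cvg_slope1 : slope1 x @[x --> +oo] --> (1 : R).
Proof.
apply: (cvg_pinfty_bound _ _ 5) => x x1; have x0 : 0 < x by exact: lt_le_trans x1.
rewrite ger0_norm ?subr_ge0 ?slope1_le1 ?(ltW x0)//.
apply: (le_trans (onem_sqr_le _ (slope1_ge0 _ (ltW x0)) (slope1_le1 _ (ltW x0)))).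
rewrite sqr_slope1 opprB addrC subrK.
have hx := hyp_ge _ (ltW x0); have h1 := hyp_ge1 x; have h0 := hyp_gt0 x.
rewrite ler_pdivrMr ?exprn_gt0// mulrAC ler_pdivlMr//.
move: (hyp x) hx h1 h0 => h hx h1 h0.
have h2 : 1 <= h ^+ 2 by rewrite exprn_ege1.
have h3 : h ^+ 2 <= h ^+ 5 by rewrite ler_weXn2l.
have h5 : 1 <= h ^+ 5 by rewrite exprn_ege1.
by rewrite (exprSr h 5) [leRHS]mulrA; apply: ler_pM; rewrite ?(ltW x0)//; lra.
Qed.

Lemma cvg_intercept1 : intercept1 x @[x --> +oo] --> (0 : R).
Proof.
apply: (cvg_pinfty_bound _ _ 2) => x x1; have x0 : 0 < x by exact: lt_le_trans x1.
have hx := hyp_ge _ (ltW x0); have h1 := hyp_ge1 x; have h0 := hyp_gt0 x.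
rewrite sub0r normrN /intercept1 exprVn ger0_norm ?divr_ge0 ?exprn_ge0 ?(ltW h0)//.
rewrite ler_pM2l// lef_pV2 ?posrE ?exprn_gt0//.
by apply: (le_trans hx); rewrite exprS ler_peMr ?(ltW h0)// exprn_ege1.
Qed.

Lemma slope1_0 : slope1 0 = 0.
Proof. by rewrite /slope1 !mul0r. Qed.

(* The ratio of slope to intercept of the tangent at x, i.e. the direction of
   the outer normal: in these directions the dual norm is the inverse of the
   intercept. *)
Definition normal x : R := x * (3 + x ^+ 2) / 2.

Lemma normalB x y : normal x - normal y =
  (x - y) * ((3 + x ^+ 2 + x * y + y ^+ 2) / 2).
Proof. by rewrite /normal; field. Qed.

Lemma normal_le x y : (normal x <= normal y) = (x <= y).
Proof.
rewrite -subr_le0 -[in RHS]subr_le0 normalB pmulr_lle0// divr_gt0//.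
have := sqr_ge0 (x + y); have := sqr_ge0 x; have := sqr_ge0 y.
by rewrite sqrrD mulr2n; lra.
Qed.

Lemma normal_inj : injective normal.
Proof.
move=> x y E; have xy : x <= y by rewrite -normal_le E.
have yx : y <= x by rewrite -normal_le E.
by apply/le_anti; rewrite xy yx.
Qed.

(** Cardano's formula: for x = d - 1/d one has x^3 + 3 x = d^3 - d^(-3), which is 2 v when d^3 = v +
    sqrt (v^2 + 1). *)
Lemma normal_surj v : exists x, normal x = v.
Proof.
pose h := Num.sqrt (v ^+ 2 + 1).
have v1 : 0 < v ^+ 2 + 1 by rewrite ltr_wpDl// sqr_ge0.
have h2 : h ^+ 2 = v ^+ 2 + 1 by rewrite sqr_sqrtr// ltW.
have p0 : 0 < v + h.
  rewrite -ltrBlDl sub0r; apply: (le_lt_trans (ler_norm _)).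
  by rewrite normrN -sqrtr_sqr ltr_sqrt// ltrDl.
pose d := powR (v + h) 3^-1.
have d0 : 0 < d by rewrite powR_gt0.
have d3 : d ^+ 3 = v + h.
  by rewrite -powR_mulrn ?powR_ge0// -powRrM mulVf// powRr1// ltW.
exists (d - d^-1); rewrite /normal.
have dn0 : d != 0 by rewrite gt_eqF.
transitivity ((d ^+ 3 - (d ^+ 3)^-1) / 2); first by field.
have -> : (d ^+ 3)^-1 = h - v.
  apply: (@mulIf _ (d ^+ 3)); first by rewrite expf_neq0.
  rewrite mulVf ?expf_neq0// d3.
  by transitivity (h ^+ 2 - v ^+ 2); [rewrite h2 addrC addKr|ring].
by rewrite d3; field.
Qed.

Definition normalI v : R := projT1 (cid (normal_surj v)).

Lemma normalIK v : normal (normalI v) = v.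
Proof. exact: projT2 (cid (normal_surj v)). Qed.

Lemma normalK x : normalI (normal x) = x.
Proof. by apply: normal_inj; rewrite normalIK. Qed.

Lemma normalI_ge0 v : 0 <= v -> 0 <= normalI v.
Proof. by move=> v0; rewrite -normal_le normalIK /normal !mul0r. Qed.

Lemma is_derive_normal x : is_derive x (1 : R) normal (3 * (1 + x ^+ 2) / 2).
Proof.
apply: is_derive1_eq _ _ _ _ (is_derive1M _ _ _ _ _
  (is_derive1M _ _ _ _ _ (is_derive1_id x) (is_derive_csqr 3 x))
  (is_derive1_cst x 2^-1)) _.
by field.
Qed.

Lemma is_derive_normalI v :
  is_derive v (1 : R) normalI (2 / (3 * (1 + normalI v ^+ 2))).
Proof.
have l0 : 3 * (1 + normalI v ^+ 2) / 2 != 0.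
  by rewrite !mulf_neq0 ?invr_neq0 ?onepsqr_neq0.
have K : {near normalI v, cancel normal normalI}.
  by near=> x; exact: normalK.
have C : \forall x \near normalI v, {for x, continuous normal}.
  near=> x; apply: differentiable_continuous; apply/derivable1_diffP.
  by have [] := is_derive_normal x.
have := @is_derive_inverse _ normal normalI _ (normalI v) K C (is_derive_normal _) l0.
by rewrite normalIK invf_div.
Unshelve. all: by end_near. Qed.

Lemma continuous_normalI : continuous normalI.
Proof.
move=> v; apply: differentiable_continuous; apply/derivable1_diffP.
by have [] := is_derive_normalI v.
Qed.

Lemma cvg_normalI : normalI v @[v --> +oo] --> +oo.
Proof.
apply/cvgryPge => A; near=> v; rewrite -normal_le normalIK.
by near: v; apply: nbhs_pinfty_ge; rewrite num_real.
Unshelve. all: by end_near. Qed.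

(** The point ([dual_intercept x], [dual_slope x]) has first norm 1 and lies on the ray through (1,
    x); it is also the gradient of the dual norm at (1, [normal x]). *)
Definition dual_slope x : R := x * (hyp x * (1 + x ^+ 2)^-1).
Definition dual_intercept x : R := hyp x * (1 + x ^+ 2)^-1.

(* The density of the dual norm. The number [w = 2 + normalI v ^+ 2] is the root
   of [w ^+ 3 - 3 * w = 4 * v ^+ 2 + 2], hence a Bernstein function of [v ^+ 2]. *)
Definition density2 v : R :=
  4 / 3 * ((hyp (normalI v))^-1 * (1 + normalI v ^+ 2)^-1 ^+ 3).
Definition slope2 v : R := dual_slope (normalI v).
Definition intercept2 v : R := dual_intercept (normalI v).

Lemma density2_ge0 v : 0 <= density2 v.
Proof.
rewrite mulr_ge0// mulr_ge0 ?exprn_ge0 ?invr_ge0 ?(ltW (hyp_gt0 _))//.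
by rewrite ltW// onepsqr_gt0.
Qed.

Lemma continuous_density2 : continuous density2.
Proof.
move=> v; apply: cvgMl_tmp; apply: cvgM.
  apply: (@continuous_comp _ _ _ normalI (fun x => (hyp x)^-1)).
    exact: continuous_normalI.
  exact: continuous_hypV.
apply: (@continuous_comp _ _ _ normalI (fun x => (1 + x ^+ 2)^-1 ^+ 3)).
  exact: continuous_normalI.
apply: (@continuous_comp _ _ _ (fun x : R => (1 + x ^+ 2)^-1) (fun y : R => y ^+ 3)).
  apply: differentiable_continuous; apply/derivable1_diffP.
  by have [] := is_derive_onepsqrV (normalI v).
exact: exprn_continuous.
Qed.

Lemma is_derive_dual_intercept x : is_derive x (1 : R) dual_intercept
  (- (x * (3 + x ^+ 2) / (hyp x * (1 + x ^+ 2) ^+ 2))).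
Proof.
apply: is_derive1_eq _ _ _ _ (is_derive1M _ _ _ _ _ (is_derive_hyp x)
  (is_derive_onepsqrV x)) _.
have h0 := hyp_neq0 x; have h2 := sqr_hyp x; have q0 := onepsqr_neq0 x.
apply: (@mulIf _ (hyp x * (1 + x ^+ 2) ^+ 2)); first by rewrite mulf_neq0 ?expf_neq0.
transitivity (x * (1 + x ^+ 2) - 2 * x * hyp x ^+ 2); first by field; rewrite h0 q0.
by rewrite h2; field; rewrite h0 q0.
Qed.

Lemma is_derive_dual_slope x : is_derive x (1 : R) dual_slope
  (2 / (hyp x * (1 + x ^+ 2) ^+ 2)).
Proof.
apply: is_derive1_eq _ _ _ _ (is_derive1M _ _ _ _ _ (is_derive1_id x)
  (is_derive_dual_intercept x)) _.
rewrite /dual_intercept.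
have h0 := hyp_neq0 x; have h2 := sqr_hyp x; have q0 := onepsqr_neq0 x.
apply: (@mulIf _ (hyp x * (1 + x ^+ 2) ^+ 2)); first by rewrite mulf_neq0 ?expf_neq0.
transitivity (hyp x ^+ 2 * (1 + x ^+ 2) - x ^+ 2 * (3 + x ^+ 2));
  first by field; rewrite h0 q0.
by rewrite h2; field; rewrite h0 q0.
Qed.

(** [density2] is the quotient of the derivatives of [dual_slope] and [normal] at x = [normalI v],
    whence its factor 4/3. *)
Lemma is_derive_slope2 v : is_derive v (1 : R) slope2 (density2 v).
Proof.
apply: is_derive1_eq slope2 _ _ _ (is_derive1_chain dual_slope normalI v _ _
  (is_derive_dual_slope _) (is_derive_normalI v)) _.
by rewrite /density2; field; rewrite hyp_neq0 onepsqr_neq0.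
Qed.

Lemma is_derive_intercept2 v : is_derive v (1 : R) intercept2 (- (v * density2 v)).
Proof.
apply: is_derive1_eq intercept2 _ _ _ (is_derive1_chain dual_intercept normalI v _ _
  (is_derive_dual_intercept _) (is_derive_normalI v)) _.
rewrite /density2 -[X in _ = - (X * _)]normalIK /normal.
by field; rewrite hyp_neq0 onepsqr_neq0.
Qed.

Lemma sqr_dual_slope x : dual_slope x ^+ 2 = 1 - (1 + x ^+ 2)^-1 ^+ 2.
Proof.
rewrite /dual_slope !exprMn sqr_hyp; field; exact: onepsqr_neq0.
Qed.

Lemma dual_slope_ge0 x : 0 <= x -> 0 <= dual_slope x.
Proof.
by move=> x0; rewrite !mulr_ge0 ?invr_ge0 ?(ltW (hyp_gt0 _)) ?(ltW (onepsqr_gt0 _)).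
Qed.

Lemma dual_slope_le1 x : 0 <= x -> dual_slope x <= 1.
Proof.
move=> x0; rewrite -(ler_pXn2r (n := 2)) ?nnegrE ?dual_slope_ge0// expr1n sqr_dual_slope.
by rewrite gerBl sqr_ge0.
Qed.

Lemma cvg_dual_slope : dual_slope x @[x --> +oo] --> (1 : R).
Proof.
apply: (cvg_pinfty_bound _ _ 1) => x x1; have x0 : 0 < x by exact: lt_le_trans x1.
rewrite ger0_norm ?subr_ge0 ?dual_slope_le1 ?(ltW x0)//.
apply: (le_trans (onem_sqr_le _ (dual_slope_ge0 _ (ltW x0)) (dual_slope_le1 _ (ltW x0)))).
rewrite sqr_dual_slope opprB addrC subrK mul1r exprVn lef_pV2 ?posrE ?exprn_gt0 ?onepsqr_gt0//.
have x2 : x <= x ^+ 2 by rewrite expr2 ler_peMr// ltW.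
by apply: (@le_trans _ _ (1 + x ^+ 2)); [lra|rewrite [leRHS]expr2 ler_peMr//; lra].
Qed.

Lemma cvg_dual_intercept : dual_intercept x @[x --> +oo] --> (0 : R).
Proof.
apply: (cvg_pinfty_bound _ _ 2) => x x1; have x0 : 0 < x by exact: lt_le_trans x1.
have h0 := hyp_gt0 x; have h2 := sqr_hyp x.
rewrite sub0r normrN ger0_norm; last first.
  by rewrite mulr_ge0 ?invr_ge0 ?(ltW h0) ?(ltW (onepsqr_gt0 _)).
have hx : hyp x <= x + 2.
  rewrite -(ler_pXn2r (n := 2)) ?nnegrE ?(ltW h0) ?addr_ge0 ?(ltW x0)// h2.
  by rewrite sqrrD mulr2n; lra.
rewrite ler_pdivrMr ?onepsqr_gt0// mulrAC ler_pdivlMr//.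
have := ler_wpM2r (ltW x0) hx; have := sqr_ge0 (x - 1); rewrite sqrrB expr1n mulr1 mulr2n.
by rewrite mulrDl -expr2; lra.
Qed.

Lemma slope2_0 : slope2 0 = 0.
Proof.
have n0 : normal 0 = 0 by rewrite /normal !mul0r.
by rewrite /slope2 -n0 normalK /dual_slope mul0r.
Qed.

Lemma cvg_slope2 : slope2 v @[v --> +oo] --> (1 : R).
Proof. exact: cvg_comp cvg_normalI cvg_dual_slope. Qed.

Lemma cvg_intercept2 : intercept2 v @[v --> +oo] --> (0 : R).
Proof. exact: cvg_comp cvg_normalI cvg_dual_intercept. Qed.

End planar_densities.

(** * Bodies of revolution *)

Section planar_duality.
Context {R : realType}.
Implicit Types x v z r s a b : R.
Local Notation halfline := [set` `[(0 : R), +oo[].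

Let k1_ge0 v : 0 <= v -> 0 <= density1 v := fun _ => density1_ge0 v.
Let k2_ge0 v : 0 <= v -> 0 <= density2 v := fun _ => density2_ge0 v.

Lemma weight_density1 : weight (@density1 R).
Proof.
exact: (weight_primitive _ _ _ k1_ge0 continuous_density1 is_derive_slope1
  is_derive_intercept1 cvg_slope1 cvg_intercept1).
Qed.

Lemma weight_density2 : weight (@density2 R).
Proof.
exact: (weight_primitive _ _ _ k2_ge0 continuous_density2 is_derive_slope2
  is_derive_intercept2 cvg_slope2 cvg_intercept2).
Qed.

Lemma cm_density1 : completely_monotone (fun z : R => 6 * (Num.sqrt (2 + z))^-1 ^+ 5).
Proof.
apply: (cm_mul (fun=> 6)); first exact: cm_cst.
apply: (cm_exprn (fun z => (Num.sqrt (2 + z))^-1)); apply: cm_inv; last first.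
  by move=> z z0; rewrite sqrtr_gt0; lra.
apply: (bernstein_root 2 (fun z => 1 * z + 2)) => //; first exact: bernstein_affine.
move=> z z0; split; last by rewrite sqr_sqrtr; lra.
by rewrite -[leLHS]sqrtr1 ler_wsqrtr//; lra.
Qed.

Let root3 z := 2 + normalI (Num.sqrt z) ^+ 2.

Let root3_ge2 z : 2 <= root3 z.
Proof. by rewrite lerDl sqr_ge0. Qed.

(** With w = 2 + y^2, the square of [normal y] is (w - 2) (w + 1)^2 / 4, and (w - 2) (w + 1)^2 = w^3
    - 3 w - 2. *)
Let bernstein_root3 : bernstein root3.
Proof.
apply: (bernstein_cubic (fun z => 4 * z + 2)).
- exact: bernstein_affine.
- by move=> z z0; lra.
- move=> z z0; split; first exact: root3_ge2.
  have E := normalIK (Num.sqrt z).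
  have : normal (normalI (Num.sqrt z)) ^+ 2 = z by rewrite E sqr_sqrtr.
  by rewrite /root3 /normal; move: (normalI _) => y <-; field.
Qed.

Lemma cm_density2 : completely_monotone
  (fun z : R => 4 / 3 * ((Num.sqrt (2 + normalI (Num.sqrt z) ^+ 2))^-1 *
    (1 + normalI (Num.sqrt z) ^+ 2)^-1 ^+ 3)).
Proof.
apply: (cm_mul (fun=> 4 / 3)); first exact: cm_cst.
apply: cm_mul.
  apply: cm_inv; last by move=> z z0; rewrite sqrtr_gt0 (lt_le_trans _ (root3_ge2 z)).
  apply: (bernstein_root 2 root3) => // z z0; have w2 := root3_ge2 z; split.
    by rewrite -[leLHS]sqrtr1 ler_wsqrtr// (le_trans _ w2)// ler1n.
  by rewrite sqr_sqrtr// (le_trans _ w2).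
apply: (cm_exprn (fun z => (1 + normalI (Num.sqrt z) ^+ 2)^-1)).
apply: cm_inv; last by move=> z z0; exact: onepsqr_gt0.
(* Negative constants are allowed in [bernstein], so w - 1 qualifies; its positivity is asked only
   by [cm_inv]. *)
apply: (bernstein_ext _ _ (bernsteinD _ _ bernstein_root3 (bernstein_affine 0 (-1) (lexx _)))).
by move=> z z0; rewrite /root3; ring.
Qed.

Lemma maxint_density1 r x : 0 <= r -> 0 <= x ->
  maxint density1 r (r * x) = r * (1 + x ^+ 2) / hyp x.
Proof.
move=> r0 x0.
rewrite (maxint_primitive _ _ _ k1_ge0 continuous_density1 is_derive_slope1
  is_derive_intercept1 slope1_0 cvg_slope1 cvg_intercept1)//.
rewrite /intercept1 /slope1 !exprVn; have h0 := hyp_neq0 x; have h2 := sqr_hyp x.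
apply: (@mulIf _ (hyp x ^+ 3)); first by rewrite expf_neq0.
transitivity (r * (2 + x ^+ 2 * (3 + x ^+ 2))); first by field.
transitivity (r * (1 + x ^+ 2) * hyp x ^+ 2); last by field.
by rewrite h2; ring.
Qed.

Lemma maxint_density2 a x : 0 <= a -> 0 <= x ->
  maxint density2 a (a * normal x) = a * hyp x ^+ 3 / 2.
Proof.
move=> a0 x0; have n0 : 0 <= normal x.
  by rewrite !mulr_ge0// addr_ge0// sqr_ge0.
rewrite (maxint_primitive _ _ _ k2_ge0 continuous_density2 is_derive_slope2
  is_derive_intercept2 slope2_0 cvg_slope2 cvg_intercept2)//.
rewrite /intercept2 /slope2 normalK /dual_slope /dual_intercept (exprS (hyp x)) sqr_hyp.
by rewrite /normal; field; exact: onepsqr_neq0.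
Qed.

Lemma maxint_density1_ge r s x : 0 <= r -> 0 <= s -> 0 <= x ->
  r * intercept1 x + s * slope1 x <= maxint density1 r s.
Proof.
exact: (maxint_ge_tangent _ _ _ k1_ge0 continuous_density1 is_derive_slope1
  is_derive_intercept1 slope1_0 cvg_slope1 cvg_intercept1).
Qed.

Lemma maxint_density10 s : 0 <= s -> maxint density1 0 s = s.
Proof.
move=> s0; have := maxintZ _ 0 1 s weight_density1 (lexx _) ler01 s0.
by rewrite mulr0 mulr1 (maxint01_primitive _ _ _ k1_ge0 continuous_density1
  is_derive_slope1 is_derive_intercept1 slope1_0 cvg_slope1 cvg_intercept1) mulr1.
Qed.

Lemma maxint_density20 s : 0 <= s -> maxint density2 0 s = s.
Proof.
move=> s0; have := maxintZ _ 0 1 s weight_density2 (lexx _) ler01 s0.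
by rewrite mulr0 mulr1 (maxint01_primitive _ _ _ k2_ge0 continuous_density2
  is_derive_slope2 is_derive_intercept2 slope2_0 cvg_slope2 cvg_intercept2) mulr1.
Qed.

Lemma intercept1_gt0 x : 0 < intercept1 x.
Proof. by rewrite mulr_gt0// exprn_gt0// invr_gt0 hyp_gt0. Qed.

Lemma slope1E x : slope1 x = normal x * intercept1 x.
Proof. by rewrite /slope1 /normal /intercept1; field; exact: hyp_neq0. Qed.

(** Choose x so that (a, b) is a multiple of the normal ([intercept1 x], [slope1 x]). The pairing is
    then the dual norm of (a, b) times the tangent at x, which lies below the first norm. For a = 0
    the tangent at infinity takes over. *)
Lemma planar_pairing r s a b : 0 <= r -> 0 <= s -> 0 <= a -> 0 <= b ->
  r * a + s * b <= maxint density1 r s * maxint density2 a b.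
Proof.
move=> r0 s0; rewrite le_eqVlt => /predU1P[<-|a0] b0.
  rewrite mulr0 add0r maxint_density20// ler_wpM2r//.
  exact: (maxint_ge_tangenty _ _ _ k1_ge0 continuous_density1 is_derive_slope1
    is_derive_intercept1 slope1_0 cvg_slope1 cvg_intercept1).
pose x := normalI (b / a).
have x0 : 0 <= x by rewrite normalI_ge0// divr_ge0// ltW.
have bE : b = a * normal x by rewrite normalIK mulrCA divff ?mulr1// gt_eqF.
have i0 := intercept1_gt0 x.
have -> : maxint density2 a b = a / intercept1 x.
  rewrite bE maxint_density2 ?(ltW a0)// /intercept1 exprVn invf_div.
  by field.
rewrite mulrA ler_pdivlMr//.
have := ler_wpM2r (ltW a0) (maxint_density1_ge r s x r0 s0 x0).
rewrite slope1E {1}bE; apply: le_trans; rewrite le_eqVlt; apply/orP; left.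
by apply/eqP; ring.
Qed.

(** The maximiser is the gradient of the first norm at (r, s). The clause on r = 0 is for the lift
    to R^n, where a vector on the axis singles out no equatorial direction. *)
Lemma planar_attained1 r s : 0 <= r -> 0 <= s -> exists a b,
  [/\ 0 <= a, 0 <= b, r = 0 -> a = 0, maxint density2 a b = 1 &
      r * a + s * b = maxint density1 r s].
Proof.
rewrite le_eqVlt => /predU1P[<-|r0] s0.
  exists 0, 1; split=> //; first by rewrite maxint_density20.
  by rewrite mul0r add0r mulr1 maxint_density10.
pose x := s / r; have x0 : 0 <= x by rewrite divr_ge0// ltW.
have sE : s = r * x by rewrite mulrCA divff ?mulr1// gt_eqF.
exists (intercept1 x), (slope1 x); split.
- exact/ltW/intercept1_gt0.
- exact: slope1_ge0.
- by move=> r00; rewrite r00 ltxx in r0.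
- rewrite slope1E mulrC maxint_density2// ?(ltW (intercept1_gt0 _))//.
  by rewrite /intercept1; field; exact: hyp_neq0.
- rewrite sE maxint_density1// ?(ltW r0)// /intercept1 /slope1.
  have h0 := hyp_neq0 x; have h2 := sqr_hyp x; rewrite !exprVn.
  apply: (@mulIf _ (hyp x ^+ 3)); first by rewrite expf_neq0.
  transitivity (r * (2 + x ^+ 2 * (3 + x ^+ 2))); first by field.
  transitivity (r * (1 + x ^+ 2) * hyp x ^+ 2); last by field.
  by rewrite h2; ring.
Qed.

(** The maximiser is the point of first norm 1 on the ray through (1, x), where x is the parameter
    whose normal points along (a, b). *)
Lemma planar_attained2 a b : 0 <= a -> 0 <= b -> exists r s,
  [/\ 0 <= r, 0 <= s, a = 0 -> r = 0, maxint density1 r s = 1 &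
      a * r + b * s = maxint density2 a b].
Proof.
rewrite le_eqVlt => /predU1P[<-|a0] b0.
  exists 0, 1; split=> //; first by rewrite maxint_density10.
  by rewrite mul0r add0r mulr1 maxint_density20.
pose x := normalI (b / a).
have x0 : 0 <= x by rewrite normalI_ge0// divr_ge0// ltW.
have bE : b = a * normal x by rewrite normalIK mulrCA divff ?mulr1// gt_eqF.
have d0 : 0 <= dual_intercept x.
  by rewrite mulr_ge0 ?invr_ge0 ?(ltW (hyp_gt0 _)) ?(ltW (onepsqr_gt0 _)).
exists (dual_intercept x), (dual_intercept x * x); split=> //.
- exact: mulr_ge0.
- by move=> a00; rewrite a00 ltxx in a0.
- rewrite maxint_density1// /dual_intercept; field.
  by rewrite hyp_neq0 onepsqr_neq0.
- rewrite bE maxint_density2 ?(ltW a0)// /dual_intercept (exprS (hyp x)) sqr_hyp.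
  by rewrite /normal; field; exact: onepsqr_neq0.
Qed.

End planar_duality.

(** * Lifting planar norms to R^n *)

Section revolution_theory.
Context {R : realType} {m : nat}.
Implicit Types (u y : 'rV[R]_m.+2).
Local Notation enorm := (@euclidean_norm R m.+2).

(** The axis is the coordinate of index 0, so that [big_ord_recl] splits it off; dimension [m.+2]
    leaves at least one equatorial coordinate. *)
Definition axis : 'rV[R]_m.+2 := delta_mx 0 ord0.
Definition equator : seq 'rV[R]_m.+2 :=
  [seq delta_mx 0 (lift ord0 j) | j <- enum 'I_m.+1].

Lemma dotv_delta u i : dotv u (delta_mx 0 i) = u 0 i.
Proof.
rewrite /dotv (bigD1 i)//= mxE !eqxx mulr1 big1 ?addr0// => j ji.
by rewrite mxE (negbTE ji) andbF mulr0.
Qed.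

Lemma sqr_seminorm_equator u :
  seminorm equator u ^+ 2 = \sum_(j < m.+1) u 0 (lift ord0 j) ^+ 2.
Proof.
rewrite /seminorm sqr_sqrtr; last by apply: sumr_ge0 => v _; exact: sqr_ge0.
rewrite /equator big_map big_enum/=.
by apply: eq_bigr => j _; rewrite dotv_delta.
Qed.

Lemma dotvE u y :
  dotv u y = u 0 ord0 * y 0 ord0 + \sum_(j < m.+1) u 0 (lift ord0 j) * y 0 (lift ord0 j).
Proof. by rewrite /dotv big_ord_recl. Qed.

Lemma sqr_enorm_axis u : enorm u ^+ 2 = u 0 ord0 ^+ 2 + seminorm equator u ^+ 2.
Proof. by rewrite sqr_enorm dotvE sqr_seminorm_equator expr2. Qed.

Lemma dotv_le_axis u y :
  dotv u y <= seminorm equator u * seminorm equator y + `|u 0 ord0| * `|y 0 ord0|.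
Proof.
pose P (x : 'rV[R]_m.+2) : 'rV[R]_m.+1 := \row_j x 0 (lift ord0 j).
have PE x : euclidean_norm (P x) = seminorm equator x.
  rewrite /euclidean_norm /seminorm big_map big_enum; congr Num.sqrt.
  by apply: eq_bigr => j _; rewrite dotv_delta !mxE expr2.
rewrite dotvE addrC; apply: lerD; last by rewrite -normrM ler_norm.
rewrite -!PE; apply: le_trans (cauchy_schwarz _ _); apply: le_trans (ler_norm _).
by rewrite le_eqVlt; apply/orP; left; apply/eqP; apply: eq_bigr => j _; rewrite !mxE.
Qed.

Lemma dotv_axis_attained u a b : 0 <= a -> 0 <= b -> (seminorm equator u = 0 -> a = 0) ->
  exists y, [/\ seminorm equator y = a, `|y 0 ord0| = b &
    dotv u y = seminorm equator u * a + `|u 0 ord0| * b].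
Proof.
move=> a0 b0 u0; pose q := seminorm equator u; pose t := u 0 ord0.
(* For q = 0 the quotient is 0, and the hypothesis gives a = 0. *)
have qa : a / q * q = a.
  by have [q0|q0] := eqVneq q 0; [rewrite (u0 q0) !mul0r|rewrite divfK].
(* [Num.sg] would vanish at t = 0, where the axial coordinate of [y] must still have absolute value
   [b]. *)
pose sg : R := if t < 0 then -1 else 1.
have sg1 : `|sg| = 1 by rewrite /sg; case: ifP; rewrite ?normrN normr1.
have tsg : t * sg = `|t|.
  by rewrite /sg; case: ltP => t0; [rewrite mulrN1 ltr0_norm|rewrite mulr1 ger0_norm].
pose y : 'rV[R]_m.+2 := \row_i (if i == ord0 then b * sg else a / q * u 0 i).
have y0 : y 0 ord0 = b * sg by rewrite mxE eqxx.
have yj j : y 0 (lift ord0 j) = a / q * u 0 (lift ord0 j) by rewrite mxE.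
exists y; split.
- apply/eqP; rewrite -(@eqrXn2 _ 2)// ?seminorm_ge0// sqr_seminorm_equator.
  under eq_bigr do rewrite yj exprMn.
  by rewrite -mulr_sumr -sqr_seminorm_equator -exprMn qa.
- by rewrite y0 normrM sg1 mulr1 ger0_norm.
- rewrite dotvE y0 addrC; congr (_ + _); last by rewrite mulrCA tsg mulrC.
  under eq_bigr do rewrite yj mulrCA -expr2.
  by rewrite -mulr_sumr -sqr_seminorm_equator expr2 mulrA qa mulrC.
Qed.

Lemma enorm_le_axis u : enorm u <= seminorm equator u + `|u 0 ord0|.
Proof.
rewrite -(ler_pXn2r (n := 2)) ?nnegrE ?enorm_ge0 ?addr_ge0 ?seminorm_ge0//.
rewrite sqr_enorm_axis sqrrD real_normK ?num_real// addrC lerD2r lerDl.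
by rewrite mulrn_wge0// mulr_ge0 ?seminorm_ge0.
Qed.

Lemma seminorm_equator_le u : seminorm equator u <= enorm u.
Proof.
rewrite -(ler_pXn2r (n := 2)) ?nnegrE ?enorm_ge0 ?seminorm_ge0// sqr_enorm_axis.
by rewrite lerDr sqr_ge0.
Qed.

Lemma seminorm_equatorZ t u : 0 <= t -> seminorm equator (t *: u) = t * seminorm equator u.
Proof.
move=> t0; apply/eqP; rewrite -(@eqrXn2 _ 2)// ?mulr_ge0 ?seminorm_ge0//.
rewrite exprMn !sqr_seminorm_equator mulr_sumr.
by apply/eqP/eq_bigr => j _; rewrite mxE exprMn.
Qed.

Definition revolution (k : R -> R) u := maxint k (seminorm equator u) `|dotv u axis|.

Lemma revolutionN k u : revolution k (- u) = revolution k u.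
Proof.
rewrite /revolution dotvNl normrN; congr (maxint _ (Num.sqrt _) _).
by apply: eq_bigr => a _; rewrite dotvNl sqrrN.
Qed.

Lemma revolutionZ k t u : weight k -> 0 <= t -> revolution k (t *: u) = t * revolution k u.
Proof.
move=> wk t0; rewrite /revolution seminorm_equatorZ// dotvZl normrM (ger0_norm t0).
by rewrite maxintZ// seminorm_ge0.
Qed.

Lemma revolution_le k : weight k -> exists2 C, 0 < C & forall u, revolution k u <= C * enorm u.
Proof.
move=> wk; have [_ k0 _] := wk.
pose I := \int[@lebesgue_measure R]_(v in [set` `[(0 : R), +oo[]) ((1 + v) * k v).
have I0 : 0 <= I.
  by apply: Rintegral_ge0 => v /halflineP v0; rewrite mulr_ge0 ?addr_ge0 ?k0.
exists (2 * I + 1) => [|u]; first by rewrite ltr_wpDl// mulr_ge0.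
have := maxint_lipschitz k (seminorm equator u) `|dotv u axis| 0 0 wk
  (seminorm_ge0 _ _) (normr_ge0 _) (lexx _) (lexx _).
have -> : maxint k 0 0 = 0.
  by have := maxintZ k 0 0 0 wk (lexx _) (lexx _) (lexx _); rewrite !mul0r.
rewrite !subr0 normr_id (ger0_norm (seminorm_ge0 _ _)) => H.
apply: (le_trans (ler_norm _)); apply: (le_trans H).
rewrite -/I (mulrDl (2 * I)) mul1r ler_wpDr ?enorm_ge0// mulrAC ler_wpM2r//.
rewrite mulr_natl mulr2n lerD ?seminorm_equator_le// dotv_delta.
exact: enorm_coord.
Qed.

Lemma dual_pair_revolution (k1 k2 : R -> R) :
  (forall r s a b, 0 <= r -> 0 <= s -> 0 <= a -> 0 <= b ->
    r * a + s * b <= maxint k1 r s * maxint k2 a b) ->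
  (forall r s, 0 <= r -> 0 <= s -> exists a b,
    [/\ 0 <= a, 0 <= b, r = 0 -> a = 0, maxint k2 a b = 1 &
      r * a + s * b = maxint k1 r s]) ->
  (forall a b, 0 <= a -> 0 <= b -> exists r s,
    [/\ 0 <= r, 0 <= s, a = 0 -> r = 0, maxint k1 r s = 1 &
      a * r + b * s = maxint k2 a b]) ->
  dual_pair (revolution k1) (revolution k2).
Proof.
move=> pair12 att1 att2; rewrite /revolution; split=> [u y|u|y].
- rewrite !dotv_delta; apply: (le_trans (dotv_le_axis u y)).
  by apply: pair12; rewrite ?seminorm_ge0.
- have [a [b [a0 b0 qa ab1 abE]]] := att1 _ _ (seminorm_ge0 equator u) (normr_ge0 (u 0 ord0)).
  have [y [yE y0 uy]] := dotv_axis_attained u a b a0 b0 qa.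
  by exists y; rewrite !dotv_delta ?yE ?y0 ?ab1// uy abE.
- have [a [b [a0 b0 qa ab1 abE]]] := att2 _ _ (seminorm_ge0 equator y) (normr_ge0 (y 0 ord0)).
  have [u [uE u0 yu]] := dotv_axis_attained y a b a0 b0 qa.
  by exists u; rewrite !dotv_delta ?uE ?u0 ?ab1// dotvC yu abE.
Qed.

End revolution_theory.

Section eq_weight.
Context {R : realType}.
Variables (k k' : R -> R).
Hypothesis kk' : forall v, 0 <= v -> k v = k' v.
Local Notation halfline := [set` `[(0 : R), +oo[].

Lemma eq_weight : weight k -> weight k'.
Proof.
have E v : v \in halfline -> k v = k' v by rewrite inE => /halflineP; exact: kk'.
move=> [mk k0 ik]; split.
- exact: eq_measurable_fun mk.
- by move=> v v0; rewrite -kk'// k0.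
- apply: eq_integrable ik => [|v vD]; first exact: measurable_itv.
  by rewrite E.
Qed.

Lemma eq_maxint r s : maxint k r s = maxint k' r s.
Proof. by apply: eq_Rintegral => v; rewrite inE => /halflineP v0; rewrite kk'. Qed.

End eq_weight.

(** * The extremal body and its distance to the ball *)

Section extremal_body.
Context {R : realType} {m : nat}.
Local Notation enorm := (@euclidean_norm R m.+2).
Local Notation axis := (@axis R m).
Local Notation equator := (@equator R m).
Local Notation N := (@revolution R m density1).
Local Notation M := (@revolution R m density2).

Lemma zonal_revolution (g k : R -> R) : completely_monotone g -> weight k ->
  (forall v, 0 <= v -> k v = g (v ^+ 2)) -> zonal (@revolution R m k).
Proof.
move=> cg wk kg.
apply: (zonal_ext _ _ (zonal_cm equator axis g cg (eq_weight _ _ kg wk))) => u.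
by rewrite /revolution (eq_maxint _ _ kg).
Qed.

Lemma zonal_revolution1 : zonal N.
Proof. exact: (zonal_revolution _ _ cm_density1 weight_density1). Qed.

Lemma zonal_revolution2 : zonal M.
Proof.
apply: (zonal_revolution _ _ cm_density2 weight_density2) => v v0.
by rewrite sqrtr_sqr ger0_norm.
Qed.

Lemma dual_pair_revolution12 : dual_pair N M.
Proof.
exact: (dual_pair_revolution _ _ planar_pairing planar_attained1 planar_attained2).
Qed.

Lemma sqr_maxint_density2_10 : maxint density2 1 0 ^+ 2 = 2 :> R.
Proof.
have := maxint_density2 1 0 ler01 (lexx (0 : R)).
rewrite /normal !mul0r mulr0 mul1r => ->.
by rewrite expr_div_n -exprM mulnC exprM sqr_hyp; field.
Qed.

(** As [normal 1] is 2, the dual norm is explicit at (1, 2): it equals [hyp 1 ^+ 3 / 2], that is 3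
    sqrt 3 / 2. *)
Lemma sqr_maxint_density2_12 : maxint density2 1 2 ^+ 2 = 27 / 4 :> R.
Proof.
have := maxint_density2 1 1 ler01 (@ler01 R).
have -> : normal 1 = 2 :> R by rewrite /normal; field.
rewrite !mul1r => ->.
by rewrite expr_div_n -exprM mulnC exprM sqr_hyp; field.
Qed.

Lemma maxint_density1_10 : maxint density1 1 0 <= 1 :> R.
Proof.
have := maxint_density1 1 0 ler01 (lexx (0 : R)).
rewrite mulr0 mul1r expr0n addr0 => ->.
by rewrite ler_pdivrMr ?hyp_gt0// mul1r hyp_ge1.
Qed.

(** Pairing with (0, 1) bounds s by the norm, and pairing with (1, 0), of dual norm sqrt 2 <= 2,
    bounds r by twice the norm; hence the constant 3. *)
Lemma enorm_le_revolution1 u : 3^-1 * enorm u <= N u.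
Proof.
rewrite ler_pdivrMl//; apply: (le_trans (enorm_le_axis u)).
rewrite /revolution dotv_delta.
set r := seminorm _ _; set s := `|_|.
have r0 : 0 <= r := seminorm_ge0 _ _; have s0 : 0 <= s := normr_ge0 _.
have := planar_pairing r s 0 1 r0 s0 (lexx _) ler01.
rewrite maxint_density20// mulr0 !mulr1 add0r => sF.
have := planar_pairing r s 1 0 r0 s0 ler01 (lexx _).
rewrite mulr0 addr0 mulr1 => rF.
have F2 : maxint density2 1 0 <= 2 :> R.
  have := sqr_maxint_density2_10; rewrite leNgt; move: (maxint density2 1 0) => x x2.
  by apply/negP => x2'; rewrite expr2 in x2; nra.
have F0 := le_trans s0 sF; have := ler_wpM2l F0 F2; lra.
Qed.

Lemma enorm_le_revolution2 u : 3^-1 * enorm u <= M u.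
Proof.
rewrite ler_pdivrMl//; apply: (le_trans (enorm_le_axis u)).
rewrite /revolution dotv_delta.
set r := seminorm _ _; set s := `|_|.
have r0 : 0 <= r := seminorm_ge0 _ _; have s0 : 0 <= s := normr_ge0 _.
have := planar_pairing 0 1 r s (lexx _) ler01 r0 s0.
rewrite maxint_density10// mul0r !mul1r add0r => sF.
have := planar_pairing 1 0 r s ler01 (lexx _) r0 s0.
rewrite mul0r addr0 mul1r => rF.
have F0 := le_trans s0 sF; have := ler_wpM2r F0 maxint_density1_10; lra.
Qed.

Let c0 : 0 < 3^-1 :> R. Proof. by rewrite invr_gt0. Qed.

(** The support function of the ball of [M] is [N], so zonality of [N] is what is needed here, and
    that of [M] for the polar. *)
Lemma zonoid_extremal : zonoid [set y | M y <= 1].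
Proof.
exact: (zonoid_dual_ball N M 3^-1 dual_pair_revolution12 c0 enorm_le_revolution1
  enorm_le_revolution2 (revolutionN _) zonal_revolution1).
Qed.

Lemma zonoid_polar_extremal : zonoid (polar [set y | M y <= 1]).
Proof.
rewrite (polar_dual_ball N M 3^-1 dual_pair_revolution12 c0 enorm_le_revolution1).
exact: (zonoid_dual_ball M N 3^-1 (dual_pair_sym _ _ dual_pair_revolution12) c0
  enorm_le_revolution2 enorm_le_revolution1 (revolutionN _) zonal_revolution2).
Qed.

Lemma revolution_plane (k : R -> R) a b :
  @revolution R m k (a *: delta_mx 0 (lift ord0 ord0) + b *: axis) = maxint k `|a| `|b|.
Proof.
rewrite /revolution dotv_delta; set y := (_ + _).
have -> : seminorm equator y = `|a|.
  apply/eqP; rewrite -(@eqrXn2 _ 2)// ?seminorm_ge0// sqr_seminorm_equator.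
  rewrite big_ord_recl big1 ?addr0 => [|j _]; last by rewrite !mxE /= !mulr0 addr0 expr0n.
  by rewrite !mxE /= mulr1 mulr0 addr0 real_normK ?num_real.
by rewrite !mxE /= mulr0 mulr1 add0r.
Qed.

(* The failure of the parallelogram law for [p = e_1] and [q = 2 e_0]: the
   squares of [M p], [M q], [M (p + q)] and [M (p - q)] are 2, 4, 27/4 and 27/4. *)
Lemma banach_mazur_extremal :
  21 / 20 <= banach_mazur [set y | M y <= 1] (@euclidean_ball R m.+2).
Proof.
have [C C0 MC] := @revolution_le R m _ weight_density2.
pose e : 'rV[R]_m.+2 := delta_mx 0 (lift ord0 ord0).
have E (a b : R) : M (a *: e + b *: axis) = maxint density2 `|a| `|b| by exact: revolution_plane.
apply: (banach_mazur_ball_ge M 3^-1 C (1 *: e + 0 *: axis) (0 *: e + 2 *: axis)) => //.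
- exact: enorm_le_revolution2.
- by move=> t y t0; exact: revolutionZ weight_density2 t0.
- have -> : 1 *: e + 0 *: axis + (0 *: e + 2 *: axis) = 1 *: e + 2 *: axis.
    by rewrite !scale0r addr0 add0r.
  have -> : 1 *: e + 0 *: axis - (0 *: e + 2 *: axis) = 1 *: e + (- 2) *: axis.
    by rewrite !scale0r addr0 add0r scaleNr.
  rewrite !E normrN !normr0 !normr1 ger0_norm// maxint_density20//.
  (* The condition reads 12 b^2 <= 27/2, and b = 21/20 gives 13.23 on the left. *)
  by rewrite sqr_maxint_density2_10 sqr_maxint_density2_12 mulr2n; lra.
- apply/negP => /eqP/matrixP/(_ 0 (lift ord0 ord0)); rewrite !mxE !eqxx/= mulr1 mulr0 addr0.
  by apply/eqP; rewrite oner_neq0.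
Qed.

End extremal_body.

Theorem mainTheorem3 (R : realType) :
  (exists delta : R, 0 < delta /\
     forall n : nat, (2 <= n)%N -> ((1 + delta)%:E <= max_bm_dist R n)%E) /\
  ~ (max_bm_dist R n @[n --> \oo] --> (1 : \bar R)%E).
Proof.
have D n : (2 <= n)%N -> ((1 + 20^-1)%:E <= max_bm_dist R n)%E.
  case: n => [//|[//|m]] _; apply: (@le_trans _ _ (banach_mazur
      [set y | @revolution R m density2 y <= 1] (@euclidean_ball R m.+2))%:E).
    rewrite lee_fin; apply: le_trans banach_mazur_extremal.
    by rewrite le_eqVlt; apply/orP; left; apply/eqP; field.
  apply: ereal_sup_ubound; exists [set y | @revolution R m density2 y <= 1] => //.
  by split; [exact: zonoid_extremal|exact: zonoid_polar_extremal].
split; first by exists 20^-1; split=> //; rewrite invr_gt0.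
move=> D1; have : ((1 + 20^-1)%:E <= 1 :> \bar R)%E.
  by apply: cvge_ge D1; exists 2%N.
by rewrite lee_fin gerDl leNgt invr_gt0 ltr0n.
Qed.
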